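(* $B(2,2,3)=17$. That is, $17$ is the least positive integer $b$ such that every coloring of the edges of $K_{b,b}$ with three colors $1,2,3$ contains a monochromatic copy of $K_{2,2}$ in color $1$, or a monochromatic copy of $K_{2,2}$ in color $2$, or a monochromatic copy of $K_{3,3}$ in color $3$.
   Context: $K_{m,n}$ denotes the complete bipartite graph with parts of sizes $m$ and $n$. The bipartite Ramsey number $B(n_1,n_2,\ldots,n_t)$ is the least positive integer $b$ such that any coloring of the edges of $K_{b,b}$ with $t$ colors results in a monochromatic copy of $K_{n_i,n_i}$ in the $i$-th color for some $i$, $1\le i\le t$. A copy of $K_{n,n}$ means a (not necessarily induced) subgraph isomorphic to $K_{n,n}$. *)

(* Defs.v *)
From mathcomp Require Import all_boot.

Set Implicit Arguments.
Unset Strict Implicit.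
Unset Printing Implicit Defensive.

(* Graphs are symmetric irreflexive relations on finite types. *)
Definition complete_bipartite (m n : nat) : rel ('I_m + 'I_n) :=
  fun x y =>
    match x, y with
    | inl _, inr _ | inr _, inl _ => true
    | _, _ => false
    end.

Lemma complete_bipartite_sym m n : symmetric (@complete_bipartite m n).
Proof. by case=> ? [] ?. Qed.

Lemma complete_bipartite_irr m n : irreflexive (@complete_bipartite m n).
Proof. by case. Qed.

(* The edge xy is the unordered pair [set x; y]. A colouring is a function on
   all sets of vertices, but only its values on edges are ever used. *)
Definition edge_coloring (t : nat) (T : finType) := {set T} -> 'I_t.

(* An injective map preserving adjacency is the same thing as an isomorphism
   onto a (not necessarily induced) subgraph; every edge of that subgraph
   must have colour i. *)
Definition monochromatic_copy (t : nat) (U T : finType) (h : rel U) (g : rel T)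
    (c : edge_coloring t T) (i : 'I_t) : Prop :=
  exists f : U -> T,
    injective f /\
    forall u v, h u v -> g (f u) (f v) /\ c [set f u; f v] = i.

Definition bipartite_ramsey_property (t : nat) (n : t.-tuple nat) (b : nat)
    : Prop :=
  forall c : edge_coloring t ('I_b + 'I_b)%type,
    exists i : 'I_t,
      monochromatic_copy (@complete_bipartite (tnth n i) (tnth n i))
                         (@complete_bipartite b b) c i.

Definition is_bipartite_ramsey_number (t : nat) (n : t.-tuple nat) (b : nat)
    : Prop :=
  [/\ 0 < b,
      bipartite_ramsey_property n b
    & forall b', 0 < b' -> bipartite_ramsey_property n b' -> b <= b'].

(* Main.v *)
(** A C4-free bipartite graph on 17 + 17 vertices has at most 74 edges and a
    K33-free one at most 140, while K_{17,17} has 289 > 74 + 74 + 140 edges. The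
    bound 74 follows from a chain of bounds for smaller graphs, obtained by
    counting pairs of neighbours and by deleting vertices.

    For the bound 140, let r be a row of degree d and consider the traces of the
    other 16 rows on its neighbourhood: any two of these blocks share at most two
    points. Let S be the sum of the sizes of the blocks. Unless d = 8 and S >= 60,
    counting triples gives S + 12 d <= d^2 + 91. The sum of d + S over all the
    rows is the sum of the squares of the column degrees; hence adding these
    inequalities for all rows and all columns cancels the squares and leaves
    22 E <= 3094.

    If d = 8 and S >= 60 then at least 12 blocks are quadruples, and these extend
    to the 14 planes of the affine space AG(3,2). Up to affine maps there are few
    possibilities for the missing planes and for the blocks with two points. For
    each of them the columns not adjacent to r, viewed as sets of rows, satisfy
    local conditions, and a branch and bound search for a clique of nine such
    sets bounds the total degree of these columns.

    For the lower bound, the edges of K_{16,16} are coloured by a partition of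
    Z4 x Z4 into two sets of four differences and the remaining eight. *)

Require Import Defs.
From mathcomp Require Import all_boot.
From mathcomp Require Import zify_ssreflect.
From Stdlib Require Import Lia.

Set Implicit Arguments.
Unset Strict Implicit.
Unset Printing Implicit Defensive.

(** * Incidence counts *)

Definition biclique_free (s t : nat) (R C : finType) (M : R -> C -> bool) :=
  [forall A : {set R}, forall B : {set C},
    (#|A| == s) && (#|B| == t) ==> [exists a in A, exists b in B, ~~ M a b]].

(** Double counting of the pairs (i, X) with X a t-subset of [F i]: two members containing the same
    X would meet in t points. *)
Lemma sum_bin_le (I T : finType) (A : {set I}) (F : I -> {set T}) (D : {set T})
    (t : nat) :
  {in A, forall i, F i \subset D} ->
  {in A &, forall i j, i != j -> #|F i :&: F j| < t} ->
  \sum_(i in A) 'C(#|F i|, t) <= 'C(#|D|, t).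
Proof.
move=> sFD Fdisj.
rewrite -cards_draws -sum1_card.
under eq_bigr => i Ai do rewrite -cards_draws -sum1_card.
rewrite (exchange_big_dep
  (fun X : {set T} => X \in [set X : {set T} | X \subset D & #|X| == t])) /=.
  apply: leq_sum => X; rewrite inE => /andP [_ /eqP cX].
  rewrite sum1dep_card; apply/card_le1_eqP => i j.
  rewrite !inE => /and3P [Ai sXi _] /and3P [Aj sXj _]; apply/eqP.
  apply: contraT => ij; have := Fdisj i j Ai Aj; rewrite eq_sym ij => /(_ isT).
  by rewrite ltnNge -cX subset_leq_card // subsetI sXi sXj.
move=> i X Ai; rewrite !inE => /andP [sX ->]; rewrite andbT.
exact: subset_trans sX (sFD i Ai).
Qed.

Section Matrix.
Variables (R C : finType) (M : R -> C -> bool).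

Definition nbr (r : R) : {set C} := [set c | M r c].
Definition conbr (c : C) : {set R} := [set r | M r c].
Definition edges (A : {set R}) (B : {set C}) := \sum_(r in A) #|nbr r :&: B|.

Lemma card_nbr (r : R) (B : {set C}) : #|nbr r :&: B| = \sum_(c in B) M r c.
Proof.
rewrite -sum1_card big_mkcond [RHS]big_mkcond /=; apply: eq_bigr => c _.
by rewrite !inE; case: (M r c); case: (c \in B).
Qed.

Lemma card_conbr (c : C) (A : {set R}) : #|conbr c :&: A| = \sum_(r in A) M r c.
Proof.
rewrite -sum1_card big_mkcond [RHS]big_mkcond /=; apply: eq_bigr => r _.
by rewrite !inE; case: (M r c); case: (r \in A).
Qed.

Lemma edges_cols (A : {set R}) (B : {set C}) :
  edges A B = \sum_(c in B) #|conbr c :&: A|.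
Proof.
rewrite /edges; under eq_bigr do rewrite card_nbr.
by rewrite exchange_big; apply: eq_bigr => c _; rewrite card_conbr.
Qed.

(* Both sides count the incidences (r', c) with c a neighbour of r; the row r
   itself contributes its degree. *)
Lemma sum_conbr_nbr (A : {set R}) (B : {set C}) (r : R) : r \in A ->
  \sum_(c in nbr r :&: B) #|conbr c :&: A| =
  #|nbr r :&: B| + \sum_(r' in A :\ r) #|nbr r :&: nbr r' :&: B|.
Proof.
move=> Ar; under eq_bigr do rewrite card_conbr.
rewrite exchange_big /= (big_setD1 r Ar) /=; congr (_ + _).
  rewrite -sum1_card; apply: eq_bigr => c; rewrite !inE => /andP [-> //].
apply: eq_bigr => r' _; rewrite -card_nbr.
by apply: eq_card => c; rewrite !inE; case: (M r' c); rewrite ?andbT ?andbF //= andbC.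
Qed.

Lemma edges_row_remove (A : {set R}) (B : {set C}) (r : R) : r \in A ->
  edges A B = #|nbr r :&: B| + edges (A :\ r) B.
Proof. exact: big_setD1. Qed.

(** An edge survives the deletion of every row but its own, so the single-row deletions together
    leave [#|A| - 1] copies of each edge. *)
Lemma edges_average (A : {set R}) (B : {set C}) (k : nat) :
  {in A, forall r, edges (A :\ r) B <= k} ->
  #|A| * edges A B <= edges A B + #|A| * k.
Proof.
move=> le_k; rewrite -[#|A| * k]sum_nat_const -sum_nat_const -big_split /=.
by apply: leq_sum => r Ar; rewrite (edges_row_remove B Ar) leq_add2l le_k.
Qed.

End Matrix.

Lemma biclique_free_tr (s t : nat) (R C : finType) (M : R -> C -> bool) :
  biclique_free s t M -> biclique_free t s (fun c r => M r c).
Proof.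
move=> /forallP fr; apply/forallP => A; apply/forallP => B.
apply/implyP => /andP [cA cB]; have /forallP/(_ A)/implyP := fr B.
rewrite cA cB => /(_ isT) /existsP [b /andP [Bb /existsP [a /andP [Aa nM]]]].
by apply/existsP; exists a; rewrite Aa; apply/existsP; exists b; rewrite Bb.
Qed.

Lemma biclique_free_common (s t : nat) (R C : finType) (M : R -> C -> bool)
    (A : {set R}) (B : {set C}) :
  biclique_free s t M -> #|A| = s -> {in A & B, forall a b, M a b} -> #|B| < t.
Proof.
move=> /forallP/(_ A)/forallP fr cA MAB; rewrite ltnNge; apply/negP => tB.
have: 0 < #|[set X : {set C} | X \subset B & #|X| == t]|.
  by rewrite cards_draws bin_gt0.
case/card_gt0P => X; rewrite inE => /andP [sXB cX].
have /implyP := fr X; rewrite cA eqxx cX => /(_ isT).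
case/existsP => a /andP [Aa /existsP [b /andP [Xb]]].
by rewrite MAB // (subsetP sXB).
Qed.

Lemma c4_free_nbr (R C : finType) (M : R -> C -> bool) (r r' : R) :
  biclique_free 2 2 M -> r != r' -> #|nbr M r :&: nbr M r'| <= 1.
Proof.
move=> fr rr'; apply: (biclique_free_common (A := [set r; r']) fr).
  by rewrite cards2 rr'.
by move=> a b; rewrite !inE => /orP [] /eqP -> /andP [].
Qed.

Section C4Free.
Variables (R C : finType) (M : R -> C -> bool).
Hypothesis fr : biclique_free 2 2 M.

Lemma c4_free_pairs (A : {set R}) (B : {set C}) :
  \sum_(r in A) 'C(#|nbr M r :&: B|, 2) <= 'C(#|B|, 2).
Proof.
apply: sum_bin_le => [r _|r r' _ _ rr']; first exact: subsetIr.
rewrite ltnS; apply: leq_trans (c4_free_nbr fr rr'); apply: subset_leq_card.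
exact: setISS (subsetIl _ _) (subsetIl _ _).
Qed.

(** Every row other than [r] shares at most one column with it, so the last sum in [sum_conbr_nbr]
    is at most [#|A| - 1]. *)
Lemma c4_free_row (A : {set R}) (B : {set C}) (r : R) : r \in A ->
  \sum_(c in nbr M r :&: B) #|conbr M c :&: A| < #|nbr M r :&: B| + #|A|.
Proof.
move=> Ar; rewrite sum_conbr_nbr // ltn_add2l [#|A|](cardsD1 r) Ar add1n ltnS.
rewrite -sum1_card; apply: leq_sum => r'; rewrite !inE => /andP [r'r _].
rewrite eq_sym in r'r; apply: leq_trans (c4_free_nbr fr r'r).
exact/subset_leq_card/subsetIl.
Qed.

End C4Free.

(** * C4-free matrices *)

(** An upper bound for a Zarankiewicz number. Submatrices are given by subsets of the index types,
    so that deleting a row or a column does not change the matrix. *)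
Definition c4_bound (m n k : nat) :=
  forall (R C : finType) (M : R -> C -> bool), biclique_free 2 2 M ->
  forall (A : {set R}) (B : {set C}), #|A| = m -> #|B| = n -> edges M A B <= k.

Lemma c4_bound_tr (m n k : nat) : c4_bound m n k -> c4_bound n m k.
Proof.
by move=> z R C M fr A B cA cB; rewrite edges_cols (z _ _ _ (biclique_free_tr fr)).
Qed.

Lemma c4_bound_average (m n k : nat) (R C : finType) (M : R -> C -> bool)
    (A : {set R}) (B : {set C}) :
  c4_bound m n k -> biclique_free 2 2 M -> #|A| = m.+1 -> #|B| = n ->
  m * edges M A B <= m.+1 * k.
Proof.
move=> z fr cA cB; have: {in A, forall r, edges M (A :\ r) B <= k}.
  by move=> r Ar; apply: z => //; apply/eqP; rewrite -eqSS -cA (cardsD1 r A) Ar.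
by move/edges_average; rewrite cA mulSn leq_add2l.
Qed.

Section DegreeBounds.
Variables (R C : finType) (M : R -> C -> bool) (A : {set R}) (B : {set C}).
Hypothesis fr : biclique_free 2 2 M.

Let a r := #|nbr M r :&: B|.
Let d c := #|conbr M c :&: A|.

Lemma c4_row_degree (m n k : nat) :
  c4_bound m n k -> #|A| = m.+1 -> #|B| = n ->
  {in A, forall r, edges M A B <= #|nbr M r :&: B| + k}.
Proof.
move=> z cA cB r Ar; rewrite (edges_row_remove M B Ar) leq_add2l; apply: z => //.
by apply/eqP; rewrite -eqSS -cA (cardsD1 r A) Ar.
Qed.

Lemma c4_col_degree (m n k : nat) :
  c4_bound m n k -> #|A| = m -> #|B| = n.+1 ->
  {in B, forall c, edges M A B <= #|conbr M c :&: A| + k}.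
Proof.
move=> z cA cB c Bc; rewrite edges_cols.
have := edges_row_remove (fun c r => M r c) A Bc; rewrite /edges /= => ->.
rewrite leq_add2l; apply: (c4_bound_tr z (biclique_free_tr fr)) => //.
by apply/eqP; rewrite -eqSS -cB (cardsD1 c B) Bc.
Qed.

(** Sum (4 - d) + 4 d <= C(d, 2) + 10 over the columns and bound the pairs by [c4_free_pairs]. With
    truncated subtraction equality holds for d = 3, 4, 5. *)
Lemma c4_deficit : \sum_(c in B) (4 - d c) + 4 * edges M A B <= 'C(#|A|, 2) + 10 * #|B|.
Proof.
have := c4_free_pairs (biclique_free_tr fr) B A.
rewrite -(leq_add2r (10 * #|B|)); apply: leq_trans.
have -> : 10 * #|B| = \sum_(c in B) 10 by rewrite sum_nat_const mulnC.
rewrite edges_cols big_distrr -!big_split /=; apply: leq_sum => c _.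
have -> : #|nbr (fun c r => M r c) c :&: A| = d c by []. rewrite -/(d c) bin2.
case: (d c) => [|[|[|[|[|[|n]]]]]] //=; nia.
Qed.

(** The column degrees along [r] sum to less than [a r + #|A|] by [c4_free_row], and to at least
    [4 * a r] minus the deficits. *)
Lemma c4_row_deficit (r : R) : r \in A ->
  3 * a r < #|A| + \sum_(c in nbr M r :&: B) (4 - d c).
Proof.
move=> Ar; have := c4_free_row fr B Ar.
rewrite -/(a r) -[X in X < _]/(\sum_(c in nbr M r :&: B) d c) => lt.
have: 4 * a r <= \sum_(c in nbr M r :&: B) (4 - d c + d c).
  by rewrite mulnC -sum_nat_const; apply: leq_sum => c _; lia.
by rewrite big_split /=; lia.
Qed.

End DegreeBounds.

Lemma leq_sum_subset (T : finType) (X Y : {set T}) (F : T -> nat) :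
  X \subset Y -> \sum_(i in X) F i <= \sum_(i in Y) F i.
Proof.
by move=> /subsetP sXY; apply: (sub_le_big leqnn) => [x y|]; rewrite ?leq_addr.
Qed.

Lemma sum_setI (T : finType) (X Y : {set T}) (F : T -> nat) :
  \sum_(i in X :&: Y) F i = \sum_(i in Y) (i \in X) * F i.
Proof.
rewrite big_mkcond [RHS]big_mkcond; apply: eq_bigr => i _; rewrite inE.
by case: (i \in X); case: (i \in Y); rewrite ?mul1n.
Qed.

Lemma sum_mem_card (T : finType) (X Y : {set T}) :
  \sum_(i in X) (i \in Y) = #|Y :&: X|.
Proof. by rewrite -sum1_card sum_setI; apply: eq_bigr => i _; rewrite muln1. Qed.

Section TotalDeficit.
Variables (R C : finType) (M : R -> C -> bool) (A : {set R}) (B : {set C}).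
Hypothesis fr : biclique_free 2 2 M.

Lemma c4_row_total_deficit (r : R) : r \in A ->
  3 * #|nbr M r :&: B| < #|A| + \sum_(c in B) (4 - #|conbr M c :&: A|).
Proof.
move=> Ar; apply: leq_trans (c4_row_deficit B fr Ar) _.
by rewrite leq_add2l leq_sum_subset // subsetIr.
Qed.

(** Without deficits a row of degree a has 3 a < 15, hence a <= 4. *)
Lemma c4_edges_of_cols :
  {in B, forall c, 4 <= #|conbr M c :&: A|} -> #|A| <= 15 ->
  edges M A B <= #|A| * 4.
Proof.
move=> ge4 A15; rewrite -sum_nat_const; apply: leq_sum => r Ar.
have := c4_row_total_deficit Ar; rewrite big1 => [|c Bc]; first lia.
by apply/eqP; rewrite subn_eq0 ge4.
Qed.

End TotalDeficit.

(** With 54 edges the total deficit is at most 78 + 140 - 216 = 2, so 3 a < 15 for every row, which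
    allows only 52 edges. *)
Lemma c4_bound_13_14 : c4_bound 13 14 53.
Proof.
move=> R C M fr A B cA cB; rewrite leqNgt; apply/negP => lt53.
have := c4_deficit A B fr; rewrite cA cB (_ : 'C(13, 2) = 78) // => def.
suff: edges M A B <= \sum_(r in A) 4 by rewrite sum_nat_const cA; lia.
by apply: leq_sum => r Ar; have := c4_row_total_deficit B fr Ar; rewrite cA; lia.
Qed.

(** With 56 edges the total deficit is at most 4 and each column has deficit at most 1. A row of
    degree 5 needs deficit 3 along its columns; two such rows share at most one column and would
    need 3 + 3 <= 4 + 1. So at most one row exceeds degree 4. *)
Lemma c4_bound_13_15 : c4_bound 13 15 55.
Proof.
move=> R C M fr A B cA cB; rewrite leqNgt; apply/negP => lt55.
have := c4_deficit A B fr; rewrite cA cB (_ : 'C(13, 2) = 78) // => def.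
have ge3 : {in B, forall c, 3 <= #|conbr M c :&: A|}.
  by move=> c Bc; have := c4_col_degree fr c4_bound_13_14 cA cB Bc; lia.
pose K r := \sum_(c in nbr M r :&: B) (4 - #|conbr M c :&: A|).
have row r : r \in A -> 3 * #|nbr M r :&: B| < 13 + K r.
  by move=> Ar; rewrite -cA; apply: c4_row_deficit.
have K4 r : K r <= 4.
  suff: K r <= \sum_(c in B) (4 - #|conbr M c :&: A|) by lia.
  by rewrite leq_sum_subset // subsetIr.
pose A5 := [set r in A | 4 < #|nbr M r :&: B|].
have A5_1 : #|A5| <= 1.
  apply/card_le1_eqP => r r'; rewrite !inE => /andP [Ar ar] /andP [Ar' ar'].
  apply/eqP; apply: contraT => rr'.
  have Kr := row r Ar; have Kr' := row r' Ar'.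
  suff: K r + K r' <= \sum_(c in B) (4 - #|conbr M c :&: A|) + 1 by lia.
  apply: (@leq_trans (\sum_(c in B) (4 - #|conbr M c :&: A| +
                        (c \in nbr M r :&: nbr M r')))).
    rewrite /K !sum_setI -big_split /=; apply: leq_sum => c Bc.
    by have := ge3 c Bc; rewrite !inE; case: (M r c); case: (M r' c) => /=; lia.
  rewrite big_split leq_add2l sum_mem_card.
  apply: leq_trans (subset_leq_card (subsetIl _ _)) _.
  by rewrite (c4_free_nbr fr) 1?eq_sym.
suff: edges M A B <= \sum_(r in A) (4 + (r \in A5)).
  rewrite big_split /= sum_nat_const cA sum_mem_card.
  by have := subset_leq_card (subsetIl A5 A); lia.
apply: leq_sum => r Ar; have := row r Ar; have := K4 r.
by rewrite !inE Ar /=; case: ltnP => /=; lia.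
Qed.

(** With 59 edges all rows have degree at least 4, so by the transposed argument all columns have
    degree at most 4. The total deficit is then 60 minus the number of edges, at most 1, which
    forces row degrees at most 4. *)
Lemma c4_bound_14_15 : c4_bound 14 15 58.
Proof.
move=> R C M fr A B cA cB; rewrite leqNgt; apply/negP => lt58.
have ge4 : {in A, forall r, 4 <= #|nbr M r :&: B|}.
  by move=> r Ar; have := c4_row_degree fr c4_bound_13_15 cA cB Ar; lia.
have le4 : {in B, forall c, #|conbr M c :&: A| <= 4}.
  move=> c Bc; have := c4_row_total_deficit A (biclique_free_tr fr) Bc.
  rewrite big1 => [|r Ar]; last by apply/eqP; rewrite subn_eq0 ge4.
  by rewrite cB /nbr -/(conbr M c); lia.
have def : \sum_(c in B) (4 - #|conbr M c :&: A|) + edges M A B = 60.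
  rewrite edges_cols -big_split /= -[60]/(15 * 4) -cB -sum_nat_const.
  by apply: eq_bigr => c Bc; rewrite subnK ?le4.
suff: edges M A B <= \sum_(r in A) 4 by rewrite sum_nat_const cA; lia.
by apply: leq_sum => r Ar; have := c4_row_total_deficit B fr Ar; rewrite cA; lia.
Qed.

Lemma c4_bound_15_15 : c4_bound 15 15 61.
Proof.
move=> R C M fr A B cA cB; rewrite leqNgt; apply/negP => lt61.
have ge4 : {in B, forall c, 4 <= #|conbr M c :&: A|}.
  by move=> c Bc; have := c4_col_degree fr (c4_bound_tr c4_bound_14_15) cA cB Bc; lia.
by have := c4_edges_of_cols fr ge4; rewrite cA; lia.
Qed.

Lemma c4_bound_15_16 : c4_bound 15 16 64.
Proof.
move=> R C M fr A B cA cB; rewrite leqNgt; apply/negP => lt64.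
have ge4 : {in B, forall c, 4 <= #|conbr M c :&: A|}.
  by move=> c Bc; have := c4_col_degree fr c4_bound_15_15 cA cB Bc; lia.
by have := c4_edges_of_cols fr ge4; rewrite cA; lia.
Qed.

Section Regular.
Variables (R C : finType) (M : R -> C -> bool) (A : {set R}) (B : {set C}).
Hypotheses (fr : biclique_free 2 2 M) (cA : #|A| = 16).
Hypothesis ge4 : {in B, forall c, 4 <= #|conbr M c :&: A|}.

Let P := [set c in B | 4 < #|conbr M c :&: A|].
Let A5 := [set r in A | 4 < #|nbr M r :&: B|].

Lemma c4_row_le5 : {in A, forall r, #|nbr M r :&: B| <= 5}.
Proof.
move=> r Ar; have := c4_row_total_deficit B fr Ar.
rewrite big1 => [|c Bc]; last by apply/eqP; rewrite subn_eq0 ge4.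
by rewrite cA; lia.
Qed.

(** Along a row of degree a >= 5 the column degrees sum to less than a + 16 <= 4 a + 1, so all of
    them equal 4. *)
Lemma c4_row5_col4 : {in A5, forall r, nbr M r :&: P = set0}.
Proof.
move=> r; rewrite inE => /andP [Ar ar]; apply/setP => c; rewrite !inE.
apply/negP => /and3P [rc Bc dc].
have := c4_free_row fr B Ar; rewrite cA (bigD1 c) ?inE ?rc //=.
rewrite [#|nbr M r :&: B|](cardsD1 c) !inE rc Bc /= in ar *.
have: #|(nbr M r :&: B) :\ c| * 4 <=
  \sum_(i in nbr M r :&: B | i != c) #|conbr M i :&: A|.
  rewrite -sum_nat_const; under [in X in X <= _]eq_bigl do rewrite !inE andbC.
  under [in X in _ <= X]eq_bigl do rewrite !inE.
  by apply: leq_sum => i /andP [/andP [_ Bi] _]; exact: ge4.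
by lia.
Qed.

(** The columns of [P] meet only rows outside of [A5]. A row with p entries in [P] contributes p <=
    1 + C(p, 2), and a pair of columns lies in at most one row. *)
Lemma c4_excess_rows :
  \sum_(c in P) #|conbr M c :&: A| <= #|A :\: A5| + 'C(#|P|, 2).
Proof.
have := edges_cols M A P; rewrite /edges => <-.
rewrite (big_setID A5) /= big1 ?add0n => [|r]; last first.
  by rewrite inE => /andP [_ r5]; rewrite c4_row5_col4 ?cards0.
apply: leq_trans (_ : _ <= \sum_(r in A :\: A5) (1 + 'C(#|nbr M r :&: P|, 2))) _.
  apply: leq_sum => r _; rewrite bin2.
  by case: #|_| => [|[|[|n]]] //=; nia.
by rewrite big_split /= sum1_card leq_add2l c4_free_pairs.
Qed.

Lemma c4_excess_edges :
  edges M A B = 4 * #|B :\: P| + \sum_(c in P) #|conbr M c :&: A|.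
Proof.
rewrite edges_cols (big_setID P) [LHS]addnC; congr (_ + _).
  rewrite mulnC -sum_nat_const; apply: eq_bigr => c; rewrite !inE => /andP [].
  by move=> + Bc; have := ge4 Bc; rewrite Bc /=; lia.
by apply: eq_bigl => c; rewrite !inE andbA andbb.
Qed.

End Regular.

(** Averaging leaves only 68 edges to exclude. Then all degrees are 4 or 5, with exactly four
    columns and four rows of degree 5, and [c4_excess_rows] would give 20 <= 12 + 6. *)
Lemma c4_bound_16_16 : c4_bound 16 16 67.
Proof.
move=> R C M fr A B cA cB; rewrite leqNgt; apply/negP => lt67.
have := c4_bound_average (c4_bound_15_16) fr cA cB => le68.
have ge4 : {in B, forall c, 4 <= #|conbr M c :&: A|}.
  by move=> c Bc; have := c4_col_degree fr (c4_bound_tr c4_bound_15_16) cA cB Bc; lia.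
have ge4r : {in A, forall r, 4 <= #|nbr M r :&: B|}.
  by move=> r Ar; have := c4_row_degree fr c4_bound_15_16 cA cB Ar; lia.
have le5 := c4_row_le5 fr cA ge4.
have le5c := c4_row_le5 (biclique_free_tr fr) cB ge4r.
have := c4_excess_rows fr cA ge4; have := c4_excess_edges fr cA ge4.
set P := [set c in B | _]; set A5 := [set r in A | _] => eqE leP.
have sPB : P \subset B by apply/subsetP => c; rewrite inE => /andP [].
have sA5A : A5 \subset A by apply/subsetP => c; rewrite inE => /andP [].
have E5 : edges M A B = 64 + #|A5|.
  rewrite -[64]/(16 * 4) -cA -sum_nat_const -(setIidPl sA5A) -sum_mem_card.
  rewrite -big_split /=; apply: eq_bigr => r Ar; rewrite inE Ar /=.
  by have := ge4r r Ar; have := le5 r Ar; case: ltnP; lia.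
have EP : \sum_(c in P) #|conbr M c :&: A| = #|P| * 5.
  rewrite -sum_nat_const; apply: eq_bigr => c; rewrite inE => /andP [Bc dc].
  by have := le5c c Bc; rewrite /nbr -/(conbr M c); lia.
have := cardsID P B; rewrite (setIidPr sPB) cB => cBP.
have := cardsID A5 A; rewrite (setIidPr sA5A) cA => cAA.
have P4 : #|P| = 4 by lia.
by move: leP; rewrite EP P4 (_ : 'C(4, 2) = 6) //; lia.
Qed.

(** Averaging leaves only 71 edges. At least 7 rows have degree 5, and with p columns of degree
    above 4 these columns hold 4 p + 3 edges, so 4 p + 3 <= 9 + C(p, 2) and 1 <= p <= 3. Hence p = 1
    and that column has degree 7; its rows have total degree at most 23 and the other nine at most
    45. *)
Lemma c4_bound_16_17 : c4_bound 16 17 70.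
Proof.
move=> R C M fr A B cA cB; rewrite leqNgt; apply/negP => lt70.
have := c4_bound_average (c4_bound_tr c4_bound_16_16) (biclique_free_tr fr) cB cA.
have -> : edges (fun c r => M r c) B A = edges M A B by rewrite [RHS]edges_cols.
move=> le71.
have ge4 : {in B, forall c, 4 <= #|conbr M c :&: A|}.
  by move=> c Bc; have := c4_col_degree fr c4_bound_16_16 cA cB Bc; lia.
have le5 := c4_row_le5 fr cA ge4.
have := c4_excess_rows fr cA ge4; have := c4_excess_edges fr cA ge4.
have row5 := c4_row5_col4 fr cA ge4.
move: row5; set P := [set c in B | _]; set A5 := [set r in A | _] => row5 eqE leP.
have sPB : P \subset B by apply/subsetP => c; rewrite inE => /andP [].
have sA5A : A5 \subset A by apply/subsetP => c; rewrite inE => /andP [].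
have := cardsID P B; rewrite (setIidPr sPB) cB => cBP.
have := cardsID A5 A; rewrite (setIidPr sA5A) cA => cAA.
have leE : edges M A B <= 64 + #|A5|.
  rewrite -[64]/(16 * 4) -cA -sum_nat_const -(setIidPl sA5A) -sum_mem_card.
  rewrite -big_split /=; apply: leq_sum => r Ar; rewrite inE Ar /=.
  by have := le5 r Ar; case: ltnP; lia.
have geP : #|P| * 5 <= \sum_(c in P) #|conbr M c :&: A|.
  by rewrite -sum_nat_const; apply: leq_sum => c; rewrite inE => /andP [].
have P3 : #|P| <= 3 by lia.
have : #|P| = 1.
  have P0 : #|P| != 0.
    by rewrite cards_eq0; apply/eqP => P0; move: eqE; rewrite P0 big_set0 setD0; lia.
  move: leP eqE; move: (\sum_(c in P) _) => X leP eqE.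
  have : #|B :\: P| = 17 - #|P| by lia.
  have cases p : p != 0 -> p <= 3 -> [\/ p = 1, p = 2 /\ 'C(p, 2) = 1 | p = 3 /\ 'C(p, 2) = 3].
    by case: p => [|[|[|[|p]]]] // _ _; [apply: Or31 | apply: Or32 | apply: Or33].
  case: (cases _ P0 P3) => [->|[p2 b2]|[p3 b3]] //; first by rewrite b2 in leP; lia.
  by rewrite b3 in leP; lia.
case/eqP/cards1P => c eqP.
have dc : #|conbr M c :&: A| = 7 by move: eqE cBP; rewrite eqP big_set1 cards1; lia.
have Bc : c \in B by rewrite (subsetP sPB) // eqP set11.
have lt24 : \sum_(r in conbr M c :&: A) #|nbr M r :&: B| < 7 + 17.
  by have := c4_free_row (biclique_free_tr fr) A Bc; rewrite -[nbr _ c]/(conbr M c) dc cB.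
have: edges M A B <= \sum_(r in conbr M c :&: A) #|nbr M r :&: B| +
    \sum_(r in A :\: conbr M c) 5.
  rewrite /edges (big_setID (conbr M c)) /= setIC leq_add2l.
  by apply: leq_sum => r; rewrite inE => /andP [_ Ar]; exact: le5.
have := cardsID (conbr M c) A; rewrite setIC dc cA sum_nat_const.
by lia.
Qed.

Lemma c4_bound_17_17 : c4_bound 17 17 74.
Proof.
by move=> R C M fr A B cA cB; have := c4_bound_average c4_bound_16_17 fr cA cB; lia.
Qed.

(** * Families of blocks meeting in at most two points *)

(** The chord of the convex function C(w, 3) through w = 3 and w = 4. *)
Lemma bin3_ge3 (w : nat) : 3 * w <= 'C(w, 3) + 8.
Proof.
elim: w => [|w IH] //; rewrite binS bin2.
by case: w IH => [|[|[|[|w]]]] //= IH; nia.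
Qed.

(** The chord through w = 4 and w = 5. *)
Lemma bin3_ge6 (w : nat) : 6 * w <= 'C(w, 3) + 20.
Proof.
elim: w => [|w IH] //; rewrite binS bin2.
by case: w IH => [|[|[|[|[|w]]]]] //= IH; nia.
Qed.

Section Blocks.
Variables (I T : finType) (A : {set I}) (F : I -> {set T}) (D : {set T}).
Hypothesis sFD : {in A, forall i, F i \subset D}.
Hypothesis F2 : {in A &, forall i j, i != j -> #|F i :&: F j| <= 2}.

Lemma blocks_triples : \sum_(i in A) 'C(#|F i|, 3) <= 'C(#|D|, 3).
Proof. exact: sum_bin_le. Qed.

Lemma blocks_le3 : 3 * (\sum_(i in A) #|F i|) <= 'C(#|D|, 3) + 8 * #|A|.
Proof.
apply: (@leq_trans (\sum_(i in A) ('C(#|F i|, 3) + 8))).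
  by rewrite big_distrr; apply: leq_sum => i _; exact: bin3_ge3.
by rewrite big_split /= sum_nat_const mulnC leq_add2r blocks_triples.
Qed.

Lemma blocks_le6 : 6 * (\sum_(i in A) #|F i|) <= 'C(#|D|, 3) + 20 * #|A|.
Proof.
apply: (@leq_trans (\sum_(i in A) ('C(#|F i|, 3) + 20))).
  by rewrite big_distrr; apply: leq_sum => i _; exact: bin3_ge6.
by rewrite big_split /= sum_nat_const mulnC leq_add2r blocks_triples.
Qed.

(* Fix a block [F i0]. The blocks containing a given pair of points outside of
   it trace disjoint sets on it. *)
Lemma blocks_outer_pairs (i0 : I) (A' : {set I}) (g : nat -> nat) (c : nat) :
  i0 \in A -> A' \subset A :\ i0 -> (forall f, f <= 2 -> 2 * g f <= c * f) ->
  \sum_(i in A') 'C(#|F i :\: F i0|, 2) * g #|F i :&: F i0| <=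
  'C(#|D :\: F i0|, 2) * (c * #|F i0|)./2.
Proof.
move=> Ai0 sA' gc; set O := D :\: F i0.
have sA i : i \in A' -> (i \in A) /\ (i != i0).
  by move=> /(subsetP sA'); rewrite !inE => /andP [].
rewrite -cards_draws -sum_nat_const.
apply: (@leq_trans (\sum_(i in A') \sum_(X : {set T} |
    (X \subset F i :\: F i0) && (#|X| == 2)) g #|F i :&: F i0|)).
  apply: leq_sum => i _; rewrite -cards_draws -sum_nat_const.
  by apply/eq_leq/eq_bigl => X; rewrite inE.
rewrite (exchange_big_dep
  (fun X : {set T} => X \in [set X : {set T} | X \subset O & #|X| == 2])) /=;
  last first.
  move=> i X /sA [Ai _] /andP [sX cX]; rewrite inE cX andbT.
  by apply: subset_trans sX _; apply: setSD; exact: sFD.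
apply: leq_sum => X; rewrite inE => /andP [sXO /eqP cX].
pose A1 := [set i in A' | X \subset F i :\: F i0].
rewrite (eq_bigl (mem A1)) => [|i]; last by rewrite !inE cX eqxx andbT.
have disj : \sum_(i in A1) 'C(#|F i :&: F i0|, 1) <= 'C(#|F i0|, 1).
  apply: sum_bin_le => [i _|i j]; first exact: subsetIr.
  rewrite !inE => /andP [/sA [Ai ii0] sXi] /andP [/sA [Aj ji0] sXj] ij.
  rewrite ltnS leqn0 cards_eq0; have := F2 Ai Aj ij; apply: contraTT.
  case/set0Pn => x; rewrite !inE => /andP [/andP [xi x0] /andP [xj _]].
  have xX : x \notin X by apply/negP => /(subsetP sXi); rewrite inE x0.
  rewrite leqNgt negbK; have : #|x |: X| = 3 by rewrite cardsU1 xX cX.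
  move=> <-; rewrite subset_leq_card // subUset sub1set inE xi xj /= subsetI.
  by rewrite (subset_trans sXi (subsetDl _ _)) (subset_trans sXj (subsetDl _ _)).
rewrite geq_half_double -mul2n big_distrr /=.
apply: leq_trans (_ : c * (\sum_(i in A1) #|F i :&: F i0|) <= _).
  rewrite big_distrr; apply: leq_sum => i; rewrite inE => /andP [/sA [Ai ii0] _].
  exact/gc/F2.
rewrite leq_mul2l; apply/orP; right; move: disj; rewrite bin1.
by under eq_bigr do rewrite bin1.
Qed.

Lemma blocks_split (i i0 : I) : #|F i| = #|F i :\: F i0| + #|F i :&: F i0|.
Proof. by rewrite addnC cardsID. Qed.

(** A block with u points outside of [F i0] and f inside satisfies 3 (u + f) <= 9 + C(u, 2) C(f + 1,
    2) for u <= 4 and f <= 2, except when u = 4 and f = 0. The products are bounded by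
    [blocks_outer_pairs]. *)
Lemma blocks_big (i0 : I) :
  i0 \in A -> #|D :\: F i0| <= 4 ->
  {in A :\ i0, forall i, #|F i :\: F i0| <= 3 \/ 0 < #|F i :&: F i0|} ->
  3 * (\sum_(i in A :\ i0) #|F i|) <=
  9 * #|A :\ i0| + 'C(#|D :\: F i0|, 2) * (3 * #|F i0|)./2.
Proof.
move=> Ai0 O4 no4.
apply: leq_trans (leq_add (leqnn _) (blocks_outer_pairs (g := fun f => 'C(f.+1, 2))
   (c := 3) Ai0 (subxx _) _)); last by move=> [|[|[|]]].
rewrite [9 * _]mulnC -sum_nat_const -big_split big_distrr /=; apply: leq_sum => i Ai.
have := no4 i Ai; move: Ai; rewrite !inE => /andP [ii0 Ai].
have := F2 Ai Ai0 ii0; have u4 : #|F i :\: F i0| <= 4.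
  by apply: leq_trans (subset_leq_card _) O4; rewrite setSD // sFD.
rewrite (blocks_split i i0).
case: #|_ :&: _| => [|[|[|f]]] //; case: #|_ :\: _| u4 => [|[|[|[|[|u]]]]] //= _ _ [] //.
Qed.

(* At most two blocks through a pair outside of [F i0] trace two points on it,
   so that at most twelve blocks have four points once one of them is the
   complement of [F i0]. *)
Lemma blocks_big_compl (i0 i1 : I) :
  i0 \in A -> i1 \in A -> i1 != i0 -> #|D :\: F i0| = 4 -> #|F i0| = 5 ->
  #|F i1 :\: F i0| = 4 -> #|F i1 :&: F i0| = 0 ->
  \sum_(i in A) #|F i| <= 9 + 3 * (#|A| - 2) + 12.
Proof.
move=> Ai0 Ai1 i10 O4 k5 u4 f0.
have Ai1' : i1 \in A :\ i0 by rewrite !inE i10.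
rewrite (big_setD1 i0 Ai0) (big_setD1 i1 Ai1') /= k5 (blocks_split i1 i0) u4 f0.
set A' := A :\ i0 :\ i1; have -> : #|A| - 2 = #|A'|.
  have := cardsD1 i0 A; have := cardsD1 i1 (A :\ i0); rewrite Ai0 Ai1' -/A'; lia.
suff: \sum_(i in A') #|F i| <= 3 * #|A'| + 12 by lia.
have le12 : \sum_(i in A') 'C(#|F i :\: F i0|, 2) * 'C(#|F i :&: F i0|, 2) <= 12.
  have := blocks_outer_pairs (g := fun f => 'C(f, 2)) (c := 1) Ai0
    (subsetDl (A :\ i0) [set i1]); rewrite -/A' O4 k5; apply.
  by move=> [|[|[|]]].
apply: leq_trans (leq_add (leqnn _) le12).
rewrite [3 * _]mulnC -sum_nat_const -big_split /=; apply: leq_sum => i.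
rewrite !inE => /and3P [ii1 ii0 Ai]; have := F2 Ai Ai0 ii0.
(* [F i1] covers the whole complement of [F i0] in [D], so another block has at most two points
   there. *)
have u2 : #|F i :\: F i0| <= 2.
  apply: leq_trans (F2 Ai Ai1 ii1); apply: subset_leq_card.
  rewrite subsetI subsetDl /=.
  have: F i1 :\: F i0 == D :\: F i0 by rewrite eqEcard setSD ?sFD //= u4 O4.
  move/eqP => eqO; apply: subset_trans (subsetDl (F i1) (F i0)).
  by rewrite eqO setSD // sFD.
rewrite (blocks_split i i0).
by case: #|_ :&: _| => [|[|[|f]]] //; case: #|_ :\: _| u2 => [|[|[|u]]].
Qed.

End Blocks.

Section Local.
Variables (I T : finType) (A : {set I}).
Hypothesis A16 : #|A| = 16.

(** If a block has k >= 5 points, [blocks_big] applies unless some block fills the complement of a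
    5-point block, which is the case of [blocks_big_compl]. *)
Lemma blocks9 (F : I -> {set T}) (D : {set T}) :
  {in A, forall i, F i \subset D} ->
  {in A &, forall i j, i != j -> #|F i :&: F j| <= 2} ->
  #|D| = 9 -> \sum_(i in A) #|F i| <= 64.
Proof.
move=> sFD F2 D9; case: (boolP [forall i in A, #|F i| <= 4]) => [/forall_inP le4|].
  by rewrite -[64]/(16 * 4) -A16 -sum_nat_const; apply: leq_sum.
case/forall_inPn => i0 Ai0; rewrite -ltnNge => k5.
have := cardsID (F i0) D; rewrite (setIidPr (sFD _ Ai0)) D9 => kO.
case: (boolP [exists i1 in A :\ i0, (3 < #|F i1 :\: F i0|) && (#|F i1 :&: F i0| == 0)]).
  case/exists_inP => i1; rewrite !inE => /andP [i10 Ai1] /andP [u4 /eqP f0].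
  have uO : #|F i1 :\: F i0| <= #|D :\: F i0|.
    by rewrite subset_leq_card // setSD // sFD.
  have := blocks_big_compl sFD F2 Ai0 Ai1 i10; rewrite A16.
  by move=> H; apply: leq_trans (H _ _ _ _) _ => //; lia.
move/exists_inPn => no4.
have A15 : #|A :\ i0| = 15 by have := cardsD1 i0 A; rewrite Ai0; lia.
have := blocks_big sFD F2 Ai0; rewrite A15 (big_setD1 i0 Ai0) /= => H.
have {H} : 3 * (\sum_(i in A :\ i0) #|F i|) <=
    9 * 15 + 'C(#|D :\: F i0|, 2) * (3 * #|F i0|)./2.
  apply: H; first by lia.
  by move=> i /no4; rewrite negb_and -leqNgt -lt0n => /orP [] ->; [left | right].
rewrite (_ : #|D :\: F i0| = 9 - #|F i0|) ?bin2; last by lia.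
have : #|F i0| <= 9 by lia.
by move: k5; case: #|F i0| => [|[|[|[|[|[|[|[|[|[|k]]]]]]]]]] //= _ _; lia.
Qed.

(** Delete each point of [D] in turn and apply [blocks9]: every incidence survives nine deletions,
    and 640 / 9 < 72. *)
Lemma blocks10 (F : I -> {set T}) (D : {set T}) :
  {in A, forall i, F i \subset D} ->
  {in A &, forall i j, i != j -> #|F i :&: F j| <= 2} ->
  #|D| = 10 -> \sum_(i in A) #|F i| <= 71.
Proof.
move=> sFD F2 D10.
have le64 j : j \in D -> \sum_(i in A) #|F i :\ j| <= 64.
  move=> Dj; apply: (@blocks9 (fun i => F i :\ j) (D :\ j)).
  - by move=> i Ai; rewrite setSD // sFD.
  - move=> i i' Ai Ai' ii'; apply: leq_trans (F2 i i' Ai Ai' ii').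
    by rewrite subset_leq_card // setISS // subsetDl.
  - by have := cardsD1 j D; rewrite Dj D10; lia.
have : \sum_(j in D) \sum_(i in A) #|F i :\ j| <= \sum_(j in D) 64.
  by apply: leq_sum => j; exact: le64.
rewrite sum_nat_const D10 exchange_big /=.
suff -> : \sum_(i in A) \sum_(j in D) #|F i :\ j| = \sum_(i in A) 9 * #|F i|.
  by rewrite -big_distrr /=; lia.
apply: eq_bigr => i Ai; apply/eqP.
rewrite -(eqn_add2r #|F i|) -{2}(setIidPl (sFD i Ai)) -sum_mem_card -big_split /=.
under eq_bigr do rewrite addnC -cardsD1.
by rewrite sum_nat_const D10; apply/eqP; lia.
Qed.

(** [blocks_le3] suffices for d <= 7 and [blocks_le6] for d >= 11. For d = 8, 9, 10 the claim reads
    S <= 59, 64, 71, which are the hypothesis, [blocks9] and [blocks10]. *)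
Lemma blocks_bound (F : I -> {set T}) (D : {set T}) :
  {in A, forall i, F i \subset D} ->
  {in A &, forall i j, i != j -> #|F i :&: F j| <= 2} ->
  #|D| <= 17 -> ~~ ((#|D| == 8) && (60 <= \sum_(i in A) #|F i|)) ->
  \sum_(i in A) #|F i| + 12 * #|D| <= #|D| * #|D| + 91.
Proof.
move=> sFD F2 D17; have := blocks_le3 sFD F2; have := blocks_le6 sFD F2.
have := blocks9 sFD F2; have := blocks10 sFD F2.
have := bin_ffact #|D| 3; rewrite A16 !ffactnS ffactn0.
rewrite -[3`!]/6; move: 'C(_, 3) (\sum_(i in A) _) D17 => b3 S.
move: #|D| => d; do 18 (case: d => [|d]; first by rewrite /=; lia).
by rewrite !ltnS ltn0.
Qed.

End Local.

(** * Search for heavy cliques of columns *)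

Fixpoint band (a b : bitseq) : bitseq :=
  match a, b with x :: a', y :: b' => (x && y) :: band a' b' | _, _ => [::] end.

Fixpoint bor (a b : bitseq) : bitseq :=
  match a, b with x :: a', y :: b' => (x || y) :: bor a' b' | _, _ => [::] end.

Fixpoint bmeet (a b : bitseq) : bool :=
  match a, b with x :: a', y :: b' => (x && y) || bmeet a' b' | _, _ => false end.

(* Variants of [all] and [has] that stop early also when evaluated eagerly. *)
Fixpoint every (T : Type) (a : pred T) (s : seq T) : bool :=
  if s is x :: r then if a x then every a r else false else true.

Fixpoint some (T : Type) (a : pred T) (s : seq T) : bool :=
  if s is x :: r then if a x then true else some a r else false.

Lemma everyE (T : Type) (a : pred T) (s : seq T) : every a s = all a s.
Proof. by elim: s => //= x s ->; case: (a x). Qed.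

Lemma someE (T : Type) (a : pred T) (s : seq T) : some a s = has a s.
Proof. by elim: s => //= x s ->; case: (a x). Qed.

(* The selections of [rows] that omit at most [s] rows, take at most [t] of the
   marked ones and cover no position more than twice. *)
Fixpoint enumerate (rows : seq (bitseq * bool)) (c1 c2 : bitseq) (t s : nat) :
    seq bitseq :=
  match rows with
  | [::] => [:: [::]]
  | (m, tr) :: rs =>
    (match s with
     | 0 => [::]
     | s'.+1 => map (cons false) (enumerate rs c1 c2 t s')
     end) ++
    (if bmeet c2 m then [::] else
     let c1' := bor c1 m in let c2' := bor c2 (band c1 m) in
     match tr, t with
     | true, 0 => [::]
     | true, t'.+1 => map (cons true) (enumerate rs c1' c2' t' s)
     | false, _ => map (cons true) (enumerate rs c1' c2' t s)
     end)
  end.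

Fixpoint cover2 (x : bitseq) (rows : seq bitseq) (c1 c2 : bitseq) : bool :=
  match x, rows with
  | true :: x', m :: rs =>
    if bmeet c2 m then false else cover2 x' rs (bor c1 m) (bor c2 (band c1 m))
  | false :: x', _ :: rs => cover2 x' rs c1 c2
  | _, _ => true
  end.

Fixpoint independent (cp : rel bitseq) (cls l : seq bitseq) :
    seq bitseq * seq bitseq :=
  match l with
  | [::] => (cls, [::])
  | x :: r =>
    if some (cp x) cls then
      let: (c, s) := independent cp cls r in (c, x :: s)
    else independent cp (x :: cls) r
  end.

(* The excess over 7: nine columns of total weight at most [n] have at most 63 + [n]
   entries. *)
Definition weight (x : bitseq) := count id x - 7.

Definition max_weight (c : seq bitseq) := foldr (fun x m => maxn (weight x) m) 0 c.

(* Splits [l] into independent sets of the compatibility graph; a clique meets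
   each of them at most once. *)
Fixpoint color_weight (f : nat) (cp : rel bitseq) (l : seq bitseq) : nat :=
  match f, l with
  | f'.+1, _ :: _ =>
    let: (c, s) := independent cp [::] l in
    max_weight c + color_weight f' cp s
  | _, _ => 0
  end.

Definition triple_ok (a b c : bitseq) := count id (band a (band b c)) <= 2.

(** Branches on whether the head [a] belongs to the clique. If it does, compatibility is
    strengthened by the condition on triples containing [a]; a colouring bound prunes the search. *)
Fixpoint clique_le (f : nat) (cp : rel bitseq) (l : seq bitseq) (n : nat) : bool :=
  match f, l with
  | f'.+1, a :: r =>
    if color_weight f cp l <= n then true else
    if n < weight a then false else
    if clique_le f' (fun b c => if cp b c then triple_ok a b c else false)
         (filter (cp a) r) (n - weight a)
    then clique_le f' cp r n else false
  | _, _ => nilp l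
  end.

(** Heavy candidates come first in [outer_check]. Once only weights at most 1 remain, nine columns
    weigh at most 9. *)
Fixpoint top_clique_le (cp : rel bitseq) (l : seq bitseq) (n : nat) : bool :=
  match l with
  | [::] => true
  | a :: r =>
    if weight a <= 1 then
      if all (fun x => weight x <= 1) r then
        if 9 <= n then true else clique_le (size l) cp l n
      else false
    else if n < weight a then false else
    if clique_le (size r) (fun b c => if cp b c then triple_ok a b c else false)
         (filter (cp a) r) (n - weight a)
    then top_clique_le cp r n else false
  end.

Definition pairs8 := [:: (0,1); (0,2); (0,3); (0,4); (0,5); (0,6); (0,7);
  (1,2); (1,3); (1,4); (1,5); (1,6); (1,7); (2,3); (2,4); (2,5); (2,6); (2,7);
  (3,4); (3,5); (3,6); (3,7); (4,5); (4,6); (4,7); (5,6); (5,7); (6,7)].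

(** Turns the condition on one outer column and two points of a block into one on coverage of single
    positions. *)
Definition pair_mask (m : bitseq) : bitseq :=
  [seq nth false m p.1 && nth false m p.2 | p <- pairs8].

(** Two outer columns and a point have at most two common rows. The list may offer more three-point
    blocks than occur, so those used by either column are limited to [t]. *)
Definition compatible (rows : seq bitseq) (tr : bitseq) (t : nat) (a b : bitseq) :=
  if cover2 (band a b) rows (nseq 8 false) (nseq 8 false)
  then count id (band tr (bor a b)) <= t else false.

(** Only columns of degree at least 8 have positive weight, so at most [size rows - 8] rows are
    omitted. Since no candidate is compatible with itself, distinct columns of a clique have
    distinct bit sequences. *)
Definition outer_check (rows : seq bitseq) (t n : nat) : bool :=
  let tr := [seq count id m == 3 | m <- rows] in
  let l := enumerate (zip (map pair_mask rows) tr) (nseq 28 false) (nseq 28 false)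
    t (size rows - 8) in
  let cand := filter (fun x => 8 < count id x) l ++ filter (fun x => count id x <= 8) l in
  let cp := compatible rows tr t in
  all (fun x => ~~ cp x x) cand && top_clique_le cp cand n.

(* The points of AG(3,2) in lexicographic order, and its 14 planes as subsets of
   the eight indices. *)
Definition points : seq bitseq :=
  [seq a :: bc | a <- [:: false; true],
    bc <- [seq [:: b; c] | b <- [:: false; true], c <- [:: false; true]]].

Definition planes : seq bitseq :=
  [seq [seq odd (count id (band l x)) == s | x <- points]
    | l <- behead points, s <- [:: false; true]].

Definition subtriples (m : bitseq) : seq bitseq :=
  [seq set_nth false m i false | i <- iota 0 8 & nth false m i].

(* Every block with three points is contained in a missing plane; [ws] lists the
   blocks with two points. *)
Definition rows_of (miss ws : seq bitseq) :=
  [seq m <- planes | m \notin miss] ++ flatten (map subtriples miss) ++ ws.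

(** * Correctness of the search *)

Lemma nth_band (a b : bitseq) (k : nat) :
  nth false (band a b) k = nth false a k && nth false b k.
Proof.
by elim: a b k => [|x a IH] [|y b] [|k] //=; rewrite ?nth_nil ?andbF ?IH.
Qed.

Lemma size_band (a b : bitseq) : size (band a b) = minn (size a) (size b).
Proof. by elim: a b => [|x a IH] [|y b] //=; rewrite ?minn0 // IH minnSS. Qed.

Lemma nth_bor (a b : bitseq) (k : nat) : size a = size b ->
  nth false (bor a b) k = nth false a k || nth false b k.
Proof.
elim: a b k => [|x a IH] [|y b] [|k] //= [sab]; first by rewrite IH.
Qed.

Lemma size_bor (a b : bitseq) : size a = size b -> size (bor a b) = size b.
Proof. by elim: a b => [|x a IH] [|y b] //= [/IH ->]. Qed.

Lemma bmeet_ex (a b : bitseq) :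
  bmeet a b -> exists k, nth false a k && nth false b k.
Proof.
elim: a b => [|x a IH] [|y b] //= /orP [xy|/IH [k kab]]; first by exists 0.
by exists k.+1.
Qed.

Definition coverage (x : bitseq) (rows : seq bitseq) (k : nat) : nat :=
  count (fun p => p.1 && nth false p.2 k) (zip x rows).

(* [c1] and [c2] mark the points covered at least once, resp. twice, so far. *)
Lemma cover2_step (n : nat) (m c1 c2 : bitseq) (f : nat -> nat) :
  size m = n -> size c1 = n -> size c2 = n ->
  (forall k, nth false c2 k ==> nth false c1 k) ->
  (forall k, nth false c1 k + nth false c2 k + (nth false m k + f k) <= 2) ->
  [/\ bmeet c2 m = false, size (bor c1 m) = n, size (bor c2 (band c1 m)) = n,
      forall k, nth false (bor c2 (band c1 m)) k ==> nth false (bor c1 m) k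
    & forall k, nth false (bor c1 m) k + nth false (bor c2 (band c1 m)) k + f k <= 2].
Proof.
move=> sm s1 s2 c21 le2.
have s12 : size c2 = size (band c1 m) by rewrite size_band s1 s2 sm minnn.
have s1m : size c1 = size m by rewrite s1 sm.
split; rewrite ?size_bor ?size_band ?s1 ?sm ?minnn //.
- apply/negP => /bmeet_ex [k /andP [k2 km]].
  by have := c21 k; have := le2 k; rewrite k2 km /= => + k1; rewrite k1; lia.
- move=> k; rewrite !nth_bor // nth_band; have := c21 k.
  by case: (nth _ c1 k); case: (nth _ c2 k); case: (nth _ m k).
- move=> k; rewrite !nth_bor // nth_band; have := c21 k; have := le2 k.
  by case: (nth _ c1 k); case: (nth _ c2 k); case: (nth _ m k) => /=; lia.
Qed.

Lemma cover2_true (n : nat) (rows : seq bitseq) (x c1 c2 : bitseq) :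
  all (fun m => size m == n) rows -> size c1 = n -> size c2 = n ->
  (forall k, nth false c2 k ==> nth false c1 k) ->
  (forall k, nth false c1 k + nth false c2 k + coverage x rows k <= 2) ->
  cover2 x rows c1 c2.
Proof.
elim: x rows c1 c2 => [|b x IH] [|m rows] c1 c2 //=; first by case: b.
move=> /andP [/eqP sm srows] s1 s2 c21 le2.
case: b le2 => le2; last exact: IH.
have [-> s1' s2' c21' le2'] := cover2_step sm s1 s2 c21 le2.
exact: IH.
Qed.

Lemma enumerate_complete (n : nat) (rows : seq bitseq) (tr x c1 c2 : bitseq)
    (t s : nat) :
  all (fun m => size m == n) rows -> size c1 = n -> size c2 = n ->
  (forall k, nth false c2 k ==> nth false c1 k) ->
  (forall k, nth false c1 k + nth false c2 k + coverage x rows k <= 2) ->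
  size tr = size rows -> size x = size rows ->
  count id (band tr x) <= t -> count negb x <= s ->
  x \in enumerate (zip rows tr) c1 c2 t s.
Proof.
elim: rows tr x c1 c2 t s => [|m rows IH] [|b tr] [|y x] c1 c2 t s //=.
move=> /andP [/eqP sm srows] s1 s2 c21 le2 [str] [sx] le_t le_s.
rewrite mem_cat; case: y le2 le_t le_s => le2 le_t le_s; apply/orP; last first.
  left; case: s le_s => [|s] //= le_s; apply: map_f; apply: IH => //.
  by apply: leq_trans le_t; rewrite andbF.
right; have [-> s1' s2' c21' le2'] := cover2_step sm s1 s2 c21 le2.
case: b le_t => le_t; last by apply: map_f; apply: IH.
by case: t le_t => [|t] //= le_t; apply: map_f; apply: IH.
Qed.

Section CliqueSound.
Variables (O : finType) (N : O -> bitseq).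

Definition pairwise_on (cp : rel bitseq) (A : {set O}) :=
  {in A &, forall o o', o != o' -> cp (N o) (N o')}.

Lemma pairwise_onS (cp : rel bitseq) (A B : {set O}) :
  A \subset B -> pairwise_on cp B -> pairwise_on cp A.
Proof. by move=> /subsetP sAB cpB o o' /sAB Bo /sAB Bo'; exact: cpB. Qed.

Lemma independentP (cp : rel bitseq) (cls l : seq bitseq) :
  let: (c, s) := independent cp cls l in
  [/\ forall x, x \in cls \/ x \in l -> (x \in c) || (x \in s),
      {subset s <= l}, size s <= size l
    & pairwise (fun x y => ~~ cp x y) cls -> pairwise (fun x y => ~~ cp x y) c].
Proof.
elim: l cls => [|x r IH] cls /=; first by split=> // x [->|].
rewrite someE; case: ifP => [hasx|/negbT/hasPn nhas].
  case: (independent _ _ _) (IH cls) => c s [mem sub sz pw]; split=> //= y.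
    rewrite inE => -[yc|/orP [/eqP ->|yr]].
    - by have /orP [->|ys] := mem y (or_introl yc); rewrite // inE ys !orbT.
    - by rewrite inE eqxx orbT.
    - by have /orP [->|ys] := mem y (or_intror yr); rewrite // inE ys !orbT.
  by rewrite !inE => /orP [->|/sub ->]; rewrite ?orbT.
case: (independent _ _ _) (IH (x :: cls)) => c s [mem sub sz pw].
split=> [y|y||pcls].
- by rewrite inE => yin; apply: mem; rewrite inE; case: yin => [->|/orP [->|->]];
    rewrite ?orbT; auto.
- by move/sub; rewrite inE => ->; rewrite orbT.
- exact: leqW.
- by apply: pw; rewrite /= pcls andbT; apply/allP => y yc; exact: nhas.
Qed.

Lemma le_max_weight (c : seq bitseq) (x : bitseq) : x \in c -> weight x <= max_weight c.
Proof.
elim: c => [|y c IH] //=; rewrite inE leq_max => /orP [/eqP -> |/IH ->].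
  by rewrite leqnn.
by rewrite orbT.
Qed.

Lemma pairwise_incompatible (cp : rel bitseq) (c : seq bitseq) (x y : bitseq) :
  pairwise (fun x y => ~~ cp x y) c -> x \in c -> y \in c -> x != y ->
  ~~ (cp x y && cp y x).
Proof.
elim: c => [|z c IH] //= /andP [/allP zc pc]; rewrite !inE.
case/orP => [/eqP ->|xc]; case/orP => [/eqP ->|yc]; rewrite ?eqxx // => xy.
- by rewrite (negbTE (zc y yc)).
- by rewrite (negbTE (zc x xc)) andbF.
- exact: IH.
Qed.

(** A clique meets an independent set at most once: two members would be compatible in both orders,
    or, having equal bit sequences, give a candidate compatible with itself. *)
Lemma color_weight_sound (f : nat) (cp : rel bitseq) (l : seq bitseq) (A : {set O}) :
  size l <= f -> {in l, forall x, cp x x = false} -> pairwise_on cp A ->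
  {in A, forall o, N o \in l} ->
  \sum_(o in A) weight (N o) <= color_weight f cp l.
Proof.
elim: f l A => [|f IH] [|x l] A // szl irr pw Al; try by
  rewrite big1 // => o /Al.
rewrite [color_weight _ _ _]/=.
have /= := independentP cp [::] (x :: l).
(* The head always joins the first independent set, so the remainder is shorter and the fuel
   suffices. *)
have sz : size (independent cp [::] (x :: l)).2 <= size l.
  rewrite /=; have := independentP cp [:: x] l.
  by case: (independent _ _ _) => c s [].
move: sz => /=; case: (independent _ _ _) => c s /= sz [mem sub _ /(_ isT) pwc].
pose A1 := [set o in A | N o \in c].
rewrite (big_setID A1) /=; apply: leq_add.
  have [->|[o oA1]] := set_0Vmem (A :&: A1); first by rewrite big_set0.
  rewrite (big_setD1 o oA1) big1 /= => [|o'].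
    by rewrite addn0; apply: le_max_weight; move: oA1; rewrite !inE => /and3P [].
  rewrite !inE => /and4P [o'o Ao' _ o'c].
  move: oA1; rewrite !inE => /and3P [Ao _ oc].
  have := pairwise_incompatible pwc oc o'c; rewrite (pw o o') 1?eq_sym //.
  rewrite (pw o' o) //; case: eqP => [eqN _|_ /(_ isT)//].
  by have := pw o' o Ao' Ao o'o; rewrite -eqN irr // eqN Al.
apply: IH => [|y /sub /irr //||o].
- exact: leq_trans sz _.
- by apply: pairwise_onS pw; exact: subsetDl.
- rewrite !inE => /andP [nc Ao]; have := mem (N o) (or_intror (Al o Ao)).
  by case/orP => // oc; rewrite Ao oc in nc.
Qed.

Definition triples_on (A : {set O}) :=
  {in A & &, forall o o' o'', o != o' -> o != o'' -> o' != o'' ->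
    triple_ok (N o) (N o') (N o'')}.

Lemma clique_branch (cp : rel bitseq) (a : bitseq) (r : seq bitseq) (A : {set O}) (o : O) :
  {in a :: r, forall x, cp x x = false} -> pairwise_on cp A -> triples_on A ->
  {in A, forall o, N o \in a :: r} -> o \in A -> N o = a ->
  let cp' := fun b c => if cp b c then triple_ok a b c else false in
  [/\ {in filter (cp a) r, forall x, cp' x x = false}, pairwise_on cp' (A :\ o),
      triples_on (A :\ o) & {in A :\ o, forall o', N o' \in filter (cp a) r}].
Proof.
move=> irr pw tri Al Ao eqa cp'; split.
- by move=> x; rewrite mem_filter => /andP [_ xr]; rewrite /cp' irr // inE xr orbT.
- move=> o1 o2; rewrite !inE => /andP [o1o Ao1] /andP [o2o Ao2] o12.
  by rewrite /cp' pw // -eqa tri // eq_sym.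
- move=> o1 o2 o3; rewrite !inE => /andP [_ ?] /andP [_ ?] /andP [_ ?].
  exact: tri.
- move=> o'; rewrite !inE => /andP [o'o Ao'].
  have cpa : cp a (N o') by rewrite -eqa pw // eq_sym.
  rewrite mem_filter cpa /=; have := Al o' Ao'; rewrite inE => /orP [/eqP eqa'|//].
  by rewrite eqa' irr ?mem_head in cpa.
Qed.

Lemma clique_le_sound (f : nat) (cp : rel bitseq) (l : seq bitseq) (n : nat) (A : {set O}) :
  size l <= f -> clique_le f cp l n -> {in l, forall x, cp x x = false} ->
  pairwise_on cp A -> triples_on A -> {in A, forall o, N o \in l} ->
  \sum_(o in A) weight (N o) <= n.
Proof.
elim: f cp l n A => [|f IH] cp [|a r] n A //= szl; try by
  move=> _ _ _ _ Al; rewrite big1 // => o /Al.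
case: ifP => [cw _|_].
  move=> irr pw tri Al; apply: leq_trans cw.
  have := color_weight_sound (f := f.+1) _ irr pw Al; exact.
case: ltnP => // wa; case: ifP => // c1 c2 irr pw tri Al.
have [/exists_inP [o Ao /eqP eqa]|/exists_inPn nex] :=
  boolP [exists o in A, N o == a]; last first.
  apply: IH c2 _ _ _ _ => // [x xr|o Ao]; first by rewrite irr // inE xr orbT.
  by have := Al o Ao; rewrite inE (negbTE (nex o Ao)).
have [irr' pw' tri' Al'] := clique_branch irr pw tri Al Ao eqa.
rewrite (big_setD1 o Ao) /= eqa -leq_subRL //.
apply: IH c1 irr' pw' tri' Al'.
by rewrite size_filter; apply: leq_trans (count_size _ _) _.
Qed.

Lemma top_clique_le_sound (cp : rel bitseq) (l : seq bitseq) (n : nat) (A : {set O}) :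
  #|A| <= 9 -> top_clique_le cp l n -> {in l, forall x, cp x x = false} ->
  pairwise_on cp A -> triples_on A -> {in A, forall o, N o \in l} ->
  \sum_(o in A) weight (N o) <= n.
Proof.
elim: l n A => [|a r IH] n A A9 /=; first by
  move=> _ _ _ _ Al; rewrite big1 // => o /Al.
case: (leqP (weight a) 1) => wa.
  have [/allP w1|//] := boolP (all _ r).
  case: (leqP 9 n) => n9 c irr pw tri Al; last first.
    have {}c : clique_le (size r).+1 cp (a :: r) n by [].
    exact: clique_le_sound c irr pw tri Al.
  apply: leq_trans n9; apply: leq_trans A9; rewrite -sum1_card leq_sum // => o /Al.
  by rewrite inE => /orP [/eqP -> //|/w1].
case: (ltnP n (weight a)) => // wan; case: ifP => // c1 c2 irr pw tri Al.
have [/exists_inP [o Ao /eqP eqa]|/exists_inPn nex] :=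
  boolP [exists o in A, N o == a]; last first.
  apply: IH c2 _ _ _ _ => // [x xr|o Ao]; first by rewrite irr // inE xr orbT.
  by have := Al o Ao; rewrite inE (negbTE (nex o Ao)).
have [irr' pw' tri' Al'] := clique_branch irr pw tri Al Ao eqa.
rewrite (big_setD1 o Ao) /= eqa -leq_subRL //.
by apply: clique_le_sound c1 irr' pw' tri' Al'; rewrite size_filter count_size.
Qed.

End CliqueSound.

Lemma count_marked (P : pred bitseq) (x : bitseq) (rows : seq bitseq) :
  count id (band (map P rows) x) = count (fun p => p.1 && P p.2) (zip x rows).
Proof.
elim: x rows => [|b x IH] [|m rows] //=; by rewrite IH andbC.
Qed.

Lemma nth_pair_mask (m : bitseq) (k : nat) :
  nth false (pair_mask m) k =
  nth false m (nth (8, 8) pairs8 k).1 && nth false m (nth (8, 8) pairs8 k).2 && (k < 28).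
Proof.
case: (ltnP k 28) => k28; last by rewrite andbF nth_default // size_map.
by rewrite (nth_map (8, 8)) ?andbT.
Qed.

Lemma outer_check_sound (O : finType) (A : {set O}) (N : O -> bitseq)
    (rows : seq bitseq) (t n : nat) :
  outer_check rows t n -> all (fun m => size m == 8) rows -> #|A| <= 9 ->
  {in A, forall o, size (N o) = size rows} ->
  {in A, forall o p, p \in pairs8 ->
    count (fun q => [&& q.1, nth false q.2 p.1 & nth false q.2 p.2])
      (zip (N o) rows) <= 2} ->
  {in A &, forall o o',
    count (fun q => q.1 && (count id q.2 == 3)) (zip (bor (N o) (N o')) rows) <= t} ->
  {in A &, forall o o' k, o != o' -> coverage (band (N o) (N o')) rows k <= 2} ->
  triples_on N A ->
  \sum_(o in A) weight (N o) <= n.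
Proof.
move=> /andP []; set cand := _ ++ _ => /allP irr top srows A9 sN pcov tcov cov tri.
pose A8 := [set o in A | 7 < count id (N o)].
have sA8 : A8 \subset A by apply/subsetP => o; rewrite inE => /andP [].
have A8A o : o \in A8 -> o \in A by exact: (subsetP sA8).
rewrite (big_setID A8) /= [X in _ + X]big1 ?addn0 => [|o]; last first.
  by rewrite !inE /weight => /andP [+ Ao]; rewrite Ao /=; case: ltnP => //; lia.
rewrite (setIidPr sA8); apply: top_clique_le_sound top _ _ _ _.
- exact: leq_trans (subset_leq_card sA8) A9.
- by move=> x /irr /negbTE.
- move=> o o' /A8A Ao /A8A Ao' oo'; rewrite /compatible.
  rewrite (cover2_true (n := 8)) ?size_nseq //.
  + by rewrite count_marked tcov.
  + by move=> k; rewrite nth_nseq if_same.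
  + by move=> k; rewrite !nth_nseq !if_same cov.
- by move=> o o' o'' /A8A ? /A8A ? /A8A ?; exact: tri.
move=> o; rewrite inE => /andP [Ao o8].
rewrite /cand mem_cat !mem_filter; rewrite -andb_orl ltnNge orNb andTb.
rewrite (enumerate_complete (n := 28)) ?size_nseq ?size_map ?sN //.
- by apply/allP => m /mapP [m' _ ->]; rewrite size_map.
- by move=> k; rewrite nth_nseq if_same.
- move=> k; rewrite !nth_nseq !if_same /=.
  have -> : coverage (N o) (map pair_mask rows) k =
      count (fun q => q.1 && nth false (pair_mask q.2) k) (zip (N o) rows).
    rewrite /coverage; elim: (N o) (rows) => [|b x IH] [|m r] //=; by rewrite IH.
  case: (ltnP k 28) => k28; last first.
    rewrite (eq_count (a2 := pred0)) ?count_pred0 // => q.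
    by rewrite nth_pair_mask ltnNge k28 !andbF.
  rewrite (eq_count (a2 := fun q => [&& q.1, nth false q.2 (nth (8, 8) pairs8 k).1
      & nth false q.2 (nth (8, 8) pairs8 k).2])) => [|q]; last first.
    by rewrite nth_pair_mask k28 andbT.
  by apply: pcov; rewrite // mem_nth.
- rewrite count_marked; apply: leq_trans (tcov o o Ao Ao).
  by elim: (N o) (rows) => [|b x IH] [|m r] //=; rewrite orbb leq_add2l.
- rewrite (eq_count (a2 := predC id)) //; have := count_predC id (N o).
  by rewrite sN //; lia.
Qed.

(** * Quadruple systems and the planes of AG(3,2) *)

Definition permute (s : seq nat) (m : bitseq) : bitseq := [seq nth false m i | i <- s].

Fixpoint bits (n : nat) : seq bitseq :=
  if n is n'.+1 then [seq b :: x | b <- [:: true; false], x <- bits n'] else [:: [::]].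

Definition quads : seq bitseq := [seq m <- bits 8 | count id m == 4].

Definition link_pairs : seq (nat * nat) := [seq p <- pairs8 | 0 < p.1].

Definition quad0 (x y z : nat) : bitseq :=
  [seq [|| k == 0, k == x, k == y | k == z] | k <- iota 0 8].

Definition conflict (q : seq bitseq) (b : bitseq) := some (fun c => 2 < count id (band b c)) q.

(* Labellings of the points 1, ..., 7 in which 1, 2, z is a line; they yield
   the 30 Fano planes on these points. *)
Definition fano_orders : seq (seq nat) :=
  flatten [seq
    let r := filter (predC1 z) [:: 3; 4; 5; 6; 7] in
    [seq [:: 0, 1, 2, z, nth 0 r 0 & map (nth 0 r) s]
      | s <- [:: [:: 1; 2; 3]; [:: 1; 3; 2]; [:: 2; 1; 3]; [:: 2; 3; 1];
                 [:: 3; 1; 2]; [:: 3; 2; 1]]]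
  | z <- [:: 3; 4; 5; 6; 7]].

(* At a leaf, [q] lists all quadruples through the point 0. For some
   labelling these are planes, and any further quadruple that is not a plane leaves
   room for fewer than 12 quadruples in total. *)
Definition link_leaf (q : seq bitseq) : bool :=
  some (fun s =>
    if every (fun b => permute s b \in planes) q then
      every (fun b => if conflict q b then true else
        if permute s b \in planes then true else
        size q + count (fun c => if conflict q c then false else
                                  count id (band b c) <= 2) quads < 11) quads
    else false) fano_orders.

(* [ts] lists the pairs still to be examined, [q] the quadruples chosen through
   the point 0, and [u] the pairs left uncovered; [n] more may be. *)
Fixpoint link (ts : seq (nat * nat)) (q : seq bitseq) (u : seq (nat * nat)) (n : nat) : bool :=
  match ts with
  | [::] => link_leaf q
  | p :: ts' =>
    if some (fun b => nth false b p.1 && nth false b p.2) q then link ts' q u n else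
    if every (fun z =>
         if (z == p.1) || (z == p.2) then true else
         let b := quad0 p.1 p.2 z in
         if conflict q b then true else
         if some (fun r => nth false b r.1 && nth false b r.2) u then true else
         link ts' (b :: q) u n) (iota 1 7)
    then match n with 0 => true | n'.+1 => link ts' q (p :: u) n' end
    else false
  end.

Lemma link_check : link link_pairs [::] [::] 3.
Proof. by vm_compute. Qed.

Lemma link_cons (p : nat * nat) (ts : seq (nat * nat)) (q : seq bitseq)
    (u : seq (nat * nat)) (n : nat) :
  link (p :: ts) q u n =
    if some (fun b => nth false b p.1 && nth false b p.2) q then link ts q u n else
    if every (fun z =>
         if (z == p.1) || (z == p.2) then true else
         let b := quad0 p.1 p.2 z in
         if conflict q b then true else
         if some (fun r => nth false b r.1 && nth false b r.2) u then true else
         link ts (b :: q) u n) (iota 1 7)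
    then match n with 0 => true | n'.+1 => link ts q (p :: u) n' end
    else false.
Proof. by []. Qed.

Lemma mem_bits (x : bitseq) : x \in bits (size x).
Proof.
elim: x => [|b x IH] //; rewrite /= !mem_cat.
by case: b; rewrite map_f ?orbT.
Qed.

Lemma mem_quads (x : bitseq) : size x = 8 -> count id x = 4 -> x \in quads.
Proof. by move=> sx cx; rewrite mem_filter cx eqxx -sx mem_bits. Qed.

Lemma count_nth_ge (s : bitseq) (l : seq nat) :
  uniq l -> all (nth false s) l -> size l <= count id s.
Proof.
move=> ul /allP al; rewrite -size_filter.
have -> : size [seq x <- s | id x] = size [seq i <- iota 0 (size s) | nth false s i].
  by rewrite !size_filter -[in LHS](mkseq_nth false s) /mkseq count_map.
apply: uniq_leq_size => // i /al si; rewrite mem_filter si mem_iota /= add0n.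
by rewrite ltnNge; apply: contraTN si => /(nth_default false) ->.
Qed.

Lemma quad0_complete (b : bitseq) (p : nat * nat) :
  b \in quads -> p \in link_pairs ->
  [&& nth false b 0, nth false b p.1 & nth false b p.2] ->
  exists2 z, z \in iota 1 7 & [&& z != p.1, z != p.2 & b == quad0 p.1 p.2 z].
Proof.
have /allP chk : all (fun b => all (fun p =>
    [&& nth false b 0, nth false b p.1 & nth false b p.2] ==>
    has (fun z => [&& z != p.1, z != p.2 & b == quad0 p.1 p.2 z]) (iota 1 7))
  link_pairs) quads by vm_compute.
by move=> /chk /allP chkb /chkb /implyP h /h /hasP [z zi zp]; exists z.
Qed.

Lemma quad0_link_count (b : bitseq) : b \in quads -> nth false b 0 ->
  count (fun p => nth false b p.1 && nth false b p.2) link_pairs = 3.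
Proof.
have /allP chk : all (fun b => nth false b 0 ==>
    (count (fun p => nth false b p.1 && nth false b p.2) link_pairs == 3)) quads
  by vm_compute.
by move=> /chk /implyP h /h /eqP.
Qed.

Section Labelling.
Variable Q : seq bitseq.
Hypotheses (uQ : uniq Q) (qQ : {subset Q <= quads}) (szQ : 12 <= size Q).
Hypothesis Q2 : {in Q &, forall b c, b != c -> count id (band b c) <= 2}.

Lemma no_conflict (q : seq bitseq) (b : bitseq) :
  {subset q <= Q} -> b \in Q -> b \notin q -> conflict q b = false.
Proof.
move=> sq bQ bq; rewrite /conflict someE; apply/hasP => -[c cq].
have bc : b != c by apply: contraNneq bq => ->.
by rewrite ltnNge Q2 // sq.
Qed.

(** If [b] in [Q] were not sent to a plane, [Q] would lie in [q], [b] and the quadruples fitting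
    with both, fewer than 12 in all. *)
Lemma link_leaf_sound (q : seq bitseq) :
  link_leaf q -> {subset q <= Q} ->
  exists2 s, s \in fano_orders & {in Q, forall b, permute s b \in planes}.
Proof.
rewrite /link_leaf someE => /hasP [s sf] + sq; rewrite everyE.
case: ifP => // /allP planar; rewrite everyE => /allP other; exists s => // b bQ.
have [bq|bq] := boolP (b \in q); first exact: planar.
have := other b (qQ bQ); rewrite no_conflict //; case: ifP => // _ lt11.
have: {subset Q <= (b :: q) ++ [seq c <- quads |
    if conflict q c then false else count id (band b c) <= 2]}.
  move=> c cQ; rewrite mem_cat inE -orbA mem_filter (qQ cQ) andbT.
  have [//|cb] := eqVneq c b; have [//|cq] := boolP (c \in q).
  by rewrite no_conflict // Q2 // eq_sym.
move/(uniq_leq_size uQ); rewrite size_cat size_filter => le.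
by have := leq_trans szQ le; rewrite (_ : size (b :: q) = (size q).+1) // addSn ltnS leqNgt lt11.
Qed.

Let covered (p : nat * nat) :=
  has (fun b => [&& nth false b 0, nth false b p.1 & nth false b p.2]) Q.

(** Follow the branch dictated by [Q]: a member through 0 containing the pair [p] has the form
    [quad0 p.1 p.2 z] and contradicts no earlier choice; if there is none, [p] uses up one of the
    [n] exceptions. *)
Lemma link_sound (ts : seq (nat * nat)) (q : seq bitseq) (u : seq (nat * nat)) (n : nat) :
  link ts q u n -> {subset q <= Q} -> {subset ts <= link_pairs} ->
  {in u, forall p, ~~ covered p} -> count (fun p => ~~ covered p) ts <= n ->
  exists2 s, s \in fano_orders & {in Q, forall b, permute s b \in planes}.
Proof.
elim: ts q u n => [|p ts IH] q u n; first by move=> /link_leaf_sound leaf sq _ _ _; exact: leaf.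
rewrite link_cons someE [count _ _]/=; case: ifP => [_ lk sq sts nu le_n|/negbT nq].
  apply: IH lk sq _ nu _; first by move=> r rts; rewrite sts // inE rts orbT.
  exact: leq_trans (leq_addl _ _) le_n.
rewrite everyE; case: ifP => // /allP ext lk sq sts nu.
have sts' : {subset ts <= link_pairs} by move=> r rts; rewrite sts // inE rts orbT.
have pl : p \in link_pairs by rewrite sts ?mem_head.
have [/hasP [b bQ bp]|np] := boolP (covered p); last first.
  case: n lk {ext} => [|n] lk //=; rewrite ltnS => le_n.
  by apply: IH lk sq sts' _ le_n => r; rewrite inE => /orP [/eqP ->|/nu].
have [z zi /and3P [zp1 zp2 /eqP eqb]] := quad0_complete (qQ bQ) pl bp.
have bq : b \notin q.
  apply: contraNN nq => bq; apply/hasP; exists b => //.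
  by case/and3P: bp => _ -> ->.
have := ext z zi; rewrite (negbTE zp1) (negbTE zp2) /= -eqb no_conflict // someE.
case: ifP => [/hasP [r ru br]|_ lk'].
  have := nu r ru; rewrite /covered => /hasPn/(_ b bQ).
  by case/and3P: bp => -> _ _; rewrite br.
rewrite add0n => le_n; apply: IH lk' _ sts' nu le_n => c.
by rewrite inE => /orP [/eqP ->|/sq].
Qed.

(** A quadruple through 0 covers three of the 21 pairs of other points, and no pair is covered
    twice. Six quadruples thus leave at most three pairs uncovered, as allowed in [link_check]. *)
Lemma sqs_labelling : 6 <= count (fun b => nth false b 0) Q ->
  exists2 s, s \in fano_orders & {in Q, forall b, permute s b \in planes}.
Proof.
move=> six; apply: link_sound link_check _ _ _ _ => //.
have countE (T : Type) (a : pred T) (l : seq T) : count a l = \sum_(x <- l) a x.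
  by rewrite -sum1_count big_mkcond.
have le1 p : p \in link_pairs ->
    \sum_(b <- Q) [&& nth false b 0, nth false b p.1 & nth false b p.2] <= covered p.
  move=> pl; rewrite -countE -size_filter /covered has_filter.
  set F := filter _ Q; have uF : uniq F by rewrite filter_uniq.
  case EF: F uF => [|b [|c r]] //=; rewrite inE negb_or -!andbA => /and3P [bc _ _].
  have : b \in F by rewrite EF mem_head.
  have : c \in F by rewrite EF !inE eqxx orbT.
  rewrite !mem_filter => /andP [/and3P [c0 c1 c2] cQ] /andP [/and3P [b0 b1 b2] bQ].
  have := Q2 bQ cQ bc; rewrite leqNgt.
  have -> : 2 < count id (band b c).
    apply: (@count_nth_ge _ [:: 0; p.1; p.2]).
      by have /allP := (isT : all (fun p => uniq [:: 0; p.1; p.2]) link_pairs); exact.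
    by rewrite /= !nth_band b0 b1 b2 c0 c1 c2.
  by [].
have: \sum_(p <- link_pairs) \sum_(b <- Q)
    [&& nth false b 0, nth false b p.1 & nth false b p.2] <= count covered link_pairs.
  rewrite countE big_seq [X in _ <= X]big_seq; exact: leq_sum.
rewrite exchange_big /= => le.
have ge18 : 18 <= \sum_(b <- Q) \sum_(p <- link_pairs)
    [&& nth false b 0, nth false b p.1 & nth false b p.2].
  apply: (@leq_trans (\sum_(b <- Q) 3 * nth false b 0)).
    by rewrite -big_distrr -countE (leq_mul (leqnn 3) six).
  rewrite big_seq [X in _ <= X]big_seq; apply: leq_sum => b bQ.
  case b0: (nth _ b 0) => //=; rewrite -countE (@quad0_link_count b) //.
  exact: qQ.
have eq21 : count covered link_pairs + count (predC covered) link_pairs = 21.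
  exact: count_predC.
rewrite -(leq_add2l (count covered link_pairs)) eq21 -[21]/(18 + 3) leq_add2r.
exact: leq_trans ge18 le.
Qed.

End Labelling.

(* Affine permutations x |-> b + x0 u + x1 v + x2 w of the indices of [points]. *)
Definition affines : seq (seq nat) :=
  [seq s <- [seq [seq index (map odd
        [seq count id [:: nth false b i; nth false x 0 && nth false uvw.1 i;
                 nth false x 1 && nth false uvw.2.1 i; nth false x 2 && nth false uvw.2.2 i]
        | i <- iota 0 3]) points | x <- points]
    | b <- points, uvw <- [seq (u, vw) | u <- points,
                                         vw <- [seq (v, w) | v <- points, w <- points]]]
  | uniq s].

Definition plane (i : nat) : bitseq := nth [::] planes i.

Definition pair_of (i j : nat) : bitseq := [seq (k == i) || (k == j) | k <- iota 0 8].

Definition pairs : seq bitseq := [seq m <- bits 8 | count id m == 2].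

(* Representatives of the missing planes and two-point blocks up to [affines]. *)
Definition normal_forms : seq (seq bitseq * seq bitseq) :=
  [:: ([:: plane 0], [::]);
      ([:: plane 0; plane 1], [::]); ([:: plane 0; plane 2], [::]);
      ([:: plane 0], [:: pair_of 0 1]); ([:: plane 0], [:: pair_of 0 2]);
      ([:: plane 0], [:: pair_of 1 3]);
      ([::], [:: pair_of 0 1; pair_of 0 1]); ([::], [:: pair_of 0 1; pair_of 0 2]);
      ([::], [:: pair_of 0 1; pair_of 2 3]); ([::], [:: pair_of 0 1; pair_of 2 4])].

Fixpoint beq (a b : bitseq) : bool :=
  match a, b with
  | [::], [::] => true
  | true :: a', true :: b' => beq a' b'
  | false :: a', false :: b' => beq a' b'
  | _, _ => false
  end.

Fixpoint beqs (s t : seq bitseq) : bool :=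
  match s, t with
  | [::], [::] => true
  | a :: s', b :: t' => if beq a b then beqs s' t' else false
  | _, _ => false
  end.

(** The last test ensures that [s] permutes the planes, so that four-point blocks remain planes
    after relabelling. *)
Definition normalizable (l : seq (seq nat)) (miss ws : seq bitseq) : bool :=
  some (fun s => let miss' := map (permute s) miss in let ws' := map (permute s) ws in
           if some (fun f => if beqs miss' f.1 then beqs ws' f.2 else false) normal_forms
           then every (fun m => m \in map (permute s) planes) planes else false) l.

(** * Columns outside of an exceptional row *)

Section Trace.
Variables (C : finType) (es : seq C).

Definition trace (X : {set C}) : bitseq := [seq c \in X | c <- es].

Lemma size_trace (X : {set C}) : size (trace X) = size es.
Proof. exact: size_map. Qed.

Lemma count_trace (X D : {set C}) : uniq es -> es =i D -> count id (trace X) = #|X :&: D|.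
Proof.
move=> ues esD; rewrite count_map -size_filter (eq_filter (a2 := mem X)) //.
have /card_uniqP <- : uniq (filter (mem X) es) by rewrite filter_uniq.
by apply: eq_card => c; rewrite mem_filter esD in_setI /=.
Qed.

Lemma band_trace (X Y : {set C}) : band (trace X) (trace Y) = trace (X :&: Y).
Proof. by rewrite /trace; elim: es => [|c s IH] //=; rewrite IH inE. Qed.

Lemma nth_trace (c0 : C) (X : {set C}) (k : nat) :
  nth false (trace X) k = (k < size es) && (nth c0 es k \in X).
Proof.
case: ltnP => kes; last by rewrite nth_default // size_trace.
by rewrite (nth_map c0).
Qed.

End Trace.

Lemma permute_trace (C : finType) (es : seq C) (c0 : C) (s : seq nat) (X : {set C}) :
  {in s, forall i, i < size es} ->
  permute s (trace es X) = trace [seq nth c0 es i | i <- s] X.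
Proof.
move=> lts; rewrite /trace /permute -map_comp; apply/eq_in_map => i /lts lti /=.
by rewrite (nth_map c0).
Qed.

Lemma relabel (C : finType) (es : seq C) (c0 : C) (s : seq nat) :
  uniq es -> size s = size es -> {subset iota 0 (size es) <= s} ->
  let es' := [seq nth c0 es i | i <- s] in
  [/\ uniq es', es' =i es, size es' = size es & {in s, forall i, i < size es}].
Proof.
move=> ues szs sub es'.
have [_ eqs] : (size (iota 0 (size es)) = size s) * (iota 0 (size es) =i s).
  by apply: uniq_min_size (iota_uniq _ _) sub _; rewrite szs size_iota.
have sub' : {subset es <= es'}.
  move=> c ces; apply/mapP; exists (index c es); last by rewrite nth_index.
  by rewrite -eqs mem_iota index_mem.
have sz' : size es' = size es by rewrite size_map.
have le' : size es' <= size es by rewrite sz'.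
have [_ eq'] := uniq_min_size ues sub' le'.
split=> [|c||i].
- exact: leq_size_uniq ues sub' le'.
- by rewrite -/es' -eq'.
- exact: sz'.
- by rewrite -eqs mem_iota add0n.
Qed.

(* Rows are identified with positions in a list of blocks, and sets of rows with
   bit sequences over these positions. *)
Section Positions.
Variables (I : finType) (A : {set I}) (rows : seq bitseq) (pos : I -> nat) (b : I -> bitseq).
Hypothesis pos_lt : {in A, forall i, pos i < size rows}.
Hypothesis pos_nth : {in A, forall i, nth [::] rows (pos i) = b i}.
Hypothesis pos_inj : {in A &, injective pos}.

Definition occupied (h : pred I) : bitseq :=
  [seq [exists i in A, (pos i == k) && h i] | k <- iota 0 (size rows)].

Lemma size_occupied (h : pred I) : size (occupied h) = size rows.
Proof. by rewrite size_map size_iota. Qed.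

Lemma count_occupied (h : pred I) (g : pred bitseq) :
  count (fun q => q.1 && g q.2) (zip (occupied h) rows) = #|[set i in A | h i && g (b i)]|.
Proof.
pose e k := [exists i in A, (pos i == k) && h i].
have -> : zip (occupied h) rows = [seq (e k, nth [::] rows k) | k <- iota 0 (size rows)].
  by rewrite -[rows in zip _ rows](mkseq_nth [::]) /mkseq zip_map.
have -> : iota 0 (size rows) = index_iota 0 (size rows) by rewrite /index_iota subn0.
rewrite count_map -sum1_count big_mkcond /= big_mkord -big_mkcond sum1dep_card.
(* [pos] is bounded only on [A]; the option makes it a total map into a finite type. *)
pose pos' i : option 'I_(size rows) := insub (pos i).
have posE i : i \in A -> omap val (pos' i) = Some (pos i).
  by move=> Ai; rewrite /pos' insubT ?pos_lt.
rewrite -(card_imset _ (@Some_inj _)).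
rewrite -(@card_in_imset _ _ pos') => [|i j]; last first.
  rewrite !inE => /andP [Ai _] /andP [Aj _] eqij; apply: pos_inj => //.
  by have := congr1 (omap val) eqij; rewrite !posE // => -[].
apply: eq_card => x; apply/imsetP/imsetP => [[k]|[i]].
  rewrite inE => /andP [/exists_inP [i Ai /andP [/eqP ik hi]] gk] ->.
  exists i; first by rewrite inE Ai hi -pos_nth // ik.
  by rewrite /pos' ik valK.
rewrite inE => /and3P [Ai hi gi] ->; exists (Ordinal (pos_lt Ai)); last first.
  by rewrite /pos' insubT ?pos_lt // => lt; congr Some; apply: val_inj.
by rewrite inE /= pos_nth // gi andbT; apply/exists_inP; exists i; rewrite ?eqxx.
Qed.

Lemma count_id_occupied (h : pred I) : count id (occupied h) = #|[set i in A | h i]|.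
Proof.
have -> : [set i in A | h i] = [set i in A | h i && predT (b i)].
  by apply/setP => i; rewrite !inE andbT.
rewrite -count_occupied.
have := size_occupied h; elim: (occupied h) (rows) => [|x s IH] [|m r] //= [/IH ->].
by rewrite andbT.
Qed.

Lemma band_occupied (h h' : pred I) :
  band (occupied h) (occupied h') = occupied (predI h h').
Proof.
apply: (@eq_from_nth _ false); first by rewrite size_band !size_occupied minnn.
move=> k; rewrite size_band !size_occupied minnn nth_band => lek.
rewrite !(nth_map 0) ?size_iota // nth_iota // add0n.
apply/andP/exists_inP => [[/exists_inP [i Ai /andP [/eqP ik hi]]]|[i Ai]].
  case/exists_inP => j Aj /andP [/eqP jk hj]; exists i => //=.
  by rewrite ik eqxx hi (pos_inj Ai Aj) // ik.
case/andP=> ik /andP [hi hi']; split; apply/exists_inP; exists i => //; exact/andP.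
Qed.

Lemma bor_occupied (h h' : pred I) :
  bor (occupied h) (occupied h') = occupied (predU h h').
Proof.
have sz : size (occupied h) = size (occupied h') by rewrite !size_occupied.
apply: (@eq_from_nth _ false); first by rewrite size_bor // !size_occupied.
move=> k; rewrite size_bor // !size_occupied nth_bor // => lek.
rewrite !(nth_map 0) ?size_iota // nth_iota // add0n.
apply/orP/exists_inP => [[] /exists_inP [i Ai /andP [ik hi]]|[i Ai]].
- by exists i; rewrite //= ik hi.
- by exists i; rewrite //= ik hi orbT.
by case/andP=> ik /orP [] hi; [left | right]; apply/exists_inP; exists i; rewrite ?ik.
Qed.

End Positions.

Lemma k33_free_rows (R C : finType) (M : R -> C -> bool) (i j k : R) :
  biclique_free 3 3 M -> i != j -> i != k -> j != k ->
  #|nbr M i :&: nbr M j :&: nbr M k| <= 2.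
Proof.
move=> fr ij ik jk; apply: (biclique_free_common (A := [set i; j; k]) fr).
  by rewrite setUC cardsU1 !inE cards2 ij ![k == _]eq_sym negb_or ik jk.
by move=> a c; rewrite !inE => /orP [/orP [] |] /eqP -> /andP [/andP [? ?] ?].
Qed.

Lemma k33_free_cols (R C : finType) (M : R -> C -> bool) (A : {set R}) (c d e : C) :
  biclique_free 3 3 M -> c != d -> c != e -> d != e ->
  #|[set i in A | [&& M i c, M i d & M i e]]| <= 2.
Proof.
move=> fr cd ce de; apply: leq_trans (k33_free_rows (biclique_free_tr fr) cd ce de).
by apply/subset_leq_card/subsetP => i; rewrite !inE => /and4P [_ -> -> ->].
Qed.

Section Outer.
Variables (R C : finType) (M : R -> C -> bool) (r0 : R).
Hypothesis fr : biclique_free 3 3 M.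

Let D := nbr M r0.
Let A : {set R} := [set~ r0].
Let F i := nbr M r0 :&: nbr M i.

Variables (es : seq C) (miss ws : seq bitseq) (t n : nat).
Hypotheses (ues : uniq es) (esD : es =i D) (sz8 : size es = 8).

Let b i := trace es (nbr M i).

Hypothesis F24 : {in A, forall i, [|| #|F i| == 2, #|F i| == 3 | #|F i| == 4]}.
Hypothesis F4 : {in A, forall i, #|F i| = 4 -> (b i \in planes) && (b i \notin miss)}.
Hypothesis F3 : {in A, forall i, #|F i| = 3 -> b i \in flatten (map subtriples miss)}.
Hypothesis F2 : [seq b i | i <- enum [set i in A | #|F i| == 2]] = ws.
Hypothesis Ft : #|[set i in A | #|F i| == 3]| <= t.

Lemma count_b (i : R) : count id (b i) = #|F i|.
Proof. by rewrite (count_trace _ ues esD) setIC. Qed.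

Let base := [seq m <- planes | m \notin miss] ++ flatten (map subtriples miss).
Let pr := enum [set i in A | #|F i| == 2].
(** Two-point blocks may coincide, so their rows are placed by enumeration; larger blocks are
    distinct and are located by their trace. *)
Let pos i := if #|F i| == 2 then size base + index i pr else index (b i) base.

Lemma rows_of_base : rows_of miss ws = base ++ ws.
Proof. by rewrite /rows_of catA. Qed.

Lemma outer_mem_base (i : R) : i \in A -> #|F i| != 2 -> b i \in base.
Proof.
move=> Ai /negbTE n2; rewrite mem_cat mem_filter.
have := F24 Ai; rewrite n2 /= => /orP [] /eqP fi; first by rewrite F3 ?orbT.
by have /andP [-> ->] := F4 Ai fi.
Qed.

Lemma outer_pos_lt : {in A, forall i, pos i < size (rows_of miss ws)}.
Proof.
move=> i Ai; rewrite rows_of_base size_cat /pos; case: ifPn => [f2|n2].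
  by rewrite ltn_add2l -F2 size_map index_mem mem_enum inE Ai.
by rewrite ltn_addr // index_mem outer_mem_base.
Qed.

Lemma outer_pos_nth : {in A, forall i, nth [::] (rows_of miss ws) (pos i) = b i}.
Proof.
move=> i Ai; rewrite rows_of_base nth_cat /pos.
have [f2|n2] := boolP (#|F i| == 2); last first.
  by rewrite index_mem outer_mem_base // nth_index // outer_mem_base.
have ipr : i \in pr by rewrite mem_enum inE Ai f2.
by rewrite ltnNge leq_addr /= addKn -F2 (nth_map i) ?index_mem // nth_index.
Qed.

(** Two rows with the same trace of at least three points would form a K33 with [r0]. *)
Lemma outer_pos_inj : {in A &, injective pos}.
Proof.
move=> i j Ai Aj; rewrite /pos; case: ifPn => fi; case: ifPn => fj eqp.
- have ipr k : k \in A -> #|F k| == 2 -> k \in pr.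
    by move=> Ak fk; rewrite mem_enum inE Ak fk.
  by have := congr1 (nth i pr) (addnI eqp); rewrite !nth_index ?ipr.
- by have := outer_mem_base Aj fj; rewrite -index_mem -eqp ltnNge leq_addr.
- by have := outer_mem_base Ai fi; rewrite -index_mem eqp ltnNge leq_addr.
apply/eqP; apply: contraT => ij.
have eqb : b i = b j.
  by rewrite -(nth_index [::] (outer_mem_base Ai fi)) eqp nth_index // outer_mem_base.
have : #|F i| <= 2.
  rewrite -count_b -[b i](_ : band (b i) (b j) = _); last by rewrite -eqb /b band_trace setIid.
  rewrite /b band_trace (count_trace _ ues esD) setIC setIA.
  by move: Ai Aj; rewrite !inE => ir jr; rewrite k33_free_rows // eq_sym.
by have := F24 Ai; rewrite (negbTE fi) /= => /orP [] /eqP ->.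
Qed.

Let N (c : C) : bitseq := occupied A (rows_of miss ws) pos (fun i => M i c).

Lemma count_outer (c : C) : c \notin D -> count id (N c) = #|conbr M c|.
Proof.
move=> cD; rewrite (count_id_occupied outer_pos_lt outer_pos_nth outer_pos_inj).
apply: eq_card => i; rewrite !inE; have [->|//] := eqVneq i r0.
by move: cD; rewrite inE => /negbTE ->.
Qed.

Lemma subtriples_size (m : bitseq) : size m = 8 -> all (fun x => size x == 8) (subtriples m).
Proof.
move=> sm; apply/allP => x /mapP [i]; rewrite mem_filter mem_iota => /andP [_ lti] ->.
by rewrite size_set_nth sm; apply/eqP/maxn_idPr; case/andP: lti.
Qed.

(** The search conditions hold because [M] has no K33 with one, two or three columns among the nine
    outer ones. Nine columns of total weight at most [n] have at most 9 * 7 + n entries. *)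
Lemma outer_bound : {subset miss <= planes} -> outer_check (rows_of miss ws) t n ->
  #|[set: C]| = 17 -> #|D| = 8 -> \sum_(c in ~: D) #|conbr M c| <= 63 + n.
Proof.
move=> smiss chk cC cD.
have c9 : #|~: D| = 9 by have := cardsC D; rewrite -cardsT cC cD; lia.
have countN h g := count_occupied outer_pos_lt outer_pos_nth outer_pos_inj h g.
have c0 : C by case: (es) sz8.
have nthb i k : nth false (b i) k = (k < 8) && M i (nth c0 es k).
  by rewrite (nth_trace es c0) sz8 inE.
have esDk k : k < 8 -> nth c0 es k \in D by move=> k8; rewrite -esD mem_nth // sz8.
have neq c k : c \in ~: D -> k < 8 -> c != nth c0 es k.
  by rewrite inE => cD' /esDk; apply: contraTneq => <-.
have planes8 : all (fun m => size m == 8) planes by vm_compute.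
have rows8 : all (fun m => size m == 8) (rows_of miss ws).
  rewrite rows_of_base !all_cat; rewrite -andbA; apply/and3P; split.
  - apply/allP => m; rewrite mem_filter => /andP [_]; exact: (allP planes8).
  - apply/allP => m /flattenP [l /mapP [p pm ->] mp].
    exact: (allP (subtriples_size (eqP (allP planes8 p (smiss p pm)))) m mp).
  - by rewrite -F2; apply/allP => m /mapP [i _ ->]; rewrite size_trace sz8.
have le := outer_check_sound (A := ~: D) (N := N) chk rows8.
have {le} : \sum_(c in ~: D) weight (N c) <= n.
  apply: le; rewrite ?c9 //.
  - by move=> c _; rewrite size_occupied.
  - move=> c Dc p pp.
    have /allP chk8 : all (fun p => [&& p.1 < 8, p.2 < 8 & p.1 < p.2]) pairs8 by [].
    have [p1 p2 p12] := and3P (chk8 p pp).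
    rewrite (countN (fun i => M i c) (fun m => nth false m p.1 && nth false m p.2)).
    apply: leq_trans (k33_free_cols A fr (neq c _ Dc p1) (neq c _ Dc p2) _); last first.
      by rewrite nth_uniq ?sz8 // neq_ltn p12.
    by apply/subset_leq_card/subsetP => i; rewrite !inE !nthb p1 p2 /= => /and4P [-> -> -> ->].
  - move=> c d _ _; rewrite bor_occupied (countN _ (fun m => count id m == 3)).
    apply: leq_trans Ft; apply/subset_leq_card/subsetP => i.
    by rewrite !inE -count_b => /and3P [-> _ ->].
  - move=> c d Dc Dd k cd; rewrite (band_occupied _ outer_pos_inj).
    rewrite /coverage (countN _ (fun m => nth false m k)).
    have [k8|k8] := ltnP k 8; last first.
      rewrite (eq_card0 (A := _)) // => i; rewrite !inE nthb ltnNge k8 !andbF //.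
    apply: leq_trans (k33_free_cols A fr cd (neq c _ Dc k8) (neq d _ Dd k8)).
    by apply/subset_leq_card/subsetP => i; rewrite !inE nthb k8 /= => /and3P [-> /andP [-> ->] ->].
  - move=> c d e _ _ _ cd ce de; rewrite /triple_ok !(band_occupied _ outer_pos_inj).
    rewrite (count_id_occupied outer_pos_lt outer_pos_nth outer_pos_inj).
    exact: k33_free_cols.
move=> le; apply: leq_trans (leq_add (leqnn 63) le).
rewrite -[63]/(9 * 7) -c9 -sum_nat_const -big_split /=; apply: leq_sum => c.
by rewrite inE => cD'; rewrite /weight count_outer //; lia.
Qed.

End Outer.

Definition complete_order (s : seq nat) := (size s == 8) && all (fun k => k \in s) (iota 0 8).

Lemma complete_orderP (s : seq nat) :
  complete_order s -> size s = 8 /\ {subset iota 0 8 <= s}.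
Proof. by case/andP => /eqP -> /allP. Qed.

Lemma fano_orders_complete : all complete_order fano_orders.
Proof. by vm_compute. Qed.

Lemma affines_complete : all complete_order affines.
Proof. by vm_compute. Qed.

Lemma permute_inj (s : seq nat) (x y : bitseq) :
  complete_order s -> size x = 8 -> size y = 8 -> permute s x = permute s y -> x = y.
Proof.
move=> /complete_orderP [_ sub] sx sy eqp; apply: (@eq_from_nth _ false); rewrite ?sx ?sy //.
move=> k k8; have ks : k \in s by rewrite sub // mem_iota.
have := congr1 (fun m => nth false m (index k s)) eqp.
by rewrite !(nth_map 0) ?index_mem // nth_index.
Qed.

(** The 16 blocks comprise [14 - size f.1] planes and [size f.2] pairs, which leaves
    [2 + size f.1 - size f.2] triples. The traces total 61 for one missing plane without pairs and
    60 otherwise, hence the bounds 8 and 9. *)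
Lemma normal_form_check (f : seq bitseq * seq bitseq) : f \in normal_forms ->
  outer_check (rows_of f.1 f.2) (2 + size f.1 - size f.2) (8 + (1 < size f.1 + size f.2)).
Proof.
have : every (fun f => outer_check (rows_of f.1 f.2) (2 + size f.1 - size f.2)
    (8 + (1 < size f.1 + size f.2))) normal_forms by vm_compute.
by rewrite everyE => /allP chk /chk.
Qed.

Lemma beqE (a b : bitseq) : beq a b -> a = b.
Proof. by elim: a b => [|[] a IH] [|[] b] //= /IH ->. Qed.

Lemma beqsE (s t : seq bitseq) : beqs s t -> s = t.
Proof. by elim: s t => [|a s IH] [|b t] //=; case: ifP => // /beqE -> /IH ->. Qed.

Lemma normalizableP (l : seq (seq nat)) (miss ws : seq bitseq) :
  normalizable l miss ws ->
  exists2 s, s \in l & {subset planes <= map (permute s) planes} /\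
    (map (permute s) miss, map (permute s) ws) \in normal_forms.
Proof.
rewrite /normalizable someE => /hasP [s sl]; rewrite someE everyE; case: ifP => //.
case/hasP => f ff; case: ifP => // /beqsE eq1 /beqsE eq2 /allP sub; exists s => //.
by split=> //; rewrite eq1 eq2 -surjective_pairing.
Qed.

Lemma normalizable_planes1 (m : bitseq) : m \in planes -> normalizable affines [:: m] [::].
Proof.
have : every (fun m => normalizable affines [:: m] [::]) planes by vm_compute.
by rewrite everyE => /allP; apply.
Qed.

Lemma normalizable_planes2 (m m' : bitseq) : m \in planes -> m' \in planes -> m != m' ->
  normalizable affines [:: m; m'] [::].
Proof.
have : every (fun m => every (fun m' => if beq m m' then true else
  normalizable affines [:: m; m'] [::]) planes) planes by vm_compute.
rewrite everyE => /allP chk /chk; rewrite everyE => /allP chk' /chk'.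
by case: ifP => // /beqE ->; rewrite eqxx.
Qed.

Lemma normalizable_plane_pair (m w : bitseq) : m \in planes -> w \in pairs ->
  normalizable affines [:: m] [:: w].
Proof.
have : every (fun m => every (fun w => normalizable affines [:: m] [:: w]) pairs) planes
  by vm_compute.
by rewrite everyE => /allP chk /chk; rewrite everyE => /allP chk'; exact: chk'.
Qed.

Lemma normalizable_pairs (w w' : bitseq) : w \in pairs -> w' \in pairs ->
  normalizable affines [::] [:: w; w'].
Proof.
have : every (fun w => every (fun w' => normalizable affines [::] [:: w; w']) pairs) pairs
  by vm_compute.
by rewrite everyE => /allP chk /chk; rewrite everyE => /allP chk'; exact: chk'.
Qed.

Lemma normalizable_all (miss ws : seq bitseq) :
  uniq miss -> {subset miss <= planes} -> {subset ws <= pairs} ->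
  (size miss, size ws) \in [:: (1, 0); (2, 0); (1, 1); (0, 2)] ->
  normalizable affines miss ws.
Proof.
move=> um sm sw; rewrite !inE !xpair_eqE.
have mem1 (T : eqType) (a : T) s : a \in a :: s by exact: mem_head.
have mem2 (T : eqType) (a b : T) s : b \in [:: a, b & s] by rewrite !inE eqxx orbT.
case: miss um sm => [|m [|m' [|m'' miss]]] um sm; case: ws sw => [|w [|w' [|w'' ws]]] sw //= _.
- by apply: normalizable_pairs; exact: sw.
- by apply: normalizable_planes1; exact: sm.
- by apply: normalizable_plane_pair; [exact: sm | exact: sw].
- apply: normalizable_planes2; try exact: sm.
  by move: um; rewrite /= inE andbT.
Qed.

Lemma mem_pairs (x : bitseq) : size x = 8 -> count id x = 2 -> x \in pairs.
Proof. by move=> sx cx; rewrite mem_filter cx eqxx -sx mem_bits. Qed.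

Lemma triple_in_plane (x : bitseq) : size x = 8 -> count id x = 3 ->
  exists2 m, m \in planes & (x \in subtriples m) && (count id (band x m) == 3).
Proof.
move=> sx cx; have : x \in [seq y <- bits 8 | count id y == 3].
  by rewrite mem_filter cx eqxx -sx mem_bits.
have /allP chk : all (fun x => has (fun m => (x \in subtriples m) &&
    (count id (band x m) == 3)) planes) [seq y <- bits 8 | count id y == 3] by vm_compute.
by move/chk/hasP => [m mp xm]; exists m.
Qed.

Lemma card_sum_pred (I : finType) (A : {set I}) (P : pred I) :
  #|[set i in A | P i]| = \sum_(i in A) P i.
Proof.
rewrite -sum1_card big_mkcond [RHS]big_mkcond; apply: eq_bigr => i _.
by rewrite inE; case: (i \in A); case: (P i).
Qed.

(** * Rows of degree 8 whose traces have total size at least 60 *)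

Section Anchor.
Variables (R C : finType) (M : R -> C -> bool) (r0 : R).
Hypothesis fr : biclique_free 3 3 M.
Hypotheses (cR : #|[set: R]| = 17) (cC : #|[set: C]| = 17).

Let D := nbr M r0.
Let A : {set R} := [set~ r0].
Let F i := nbr M r0 :&: nbr M i.

Hypotheses (cD : #|D| = 8) (S60 : 60 <= \sum_(i in A) #|F i|).

Let cA : #|A| = 16.
Proof. by have := cardsC [set r0]; rewrite cards1 -cardsT cR /A; lia. Qed.

Let sFD : {in A, forall i, F i \subset D}.
Proof. by move=> i _; exact: subsetIl. Qed.

Let F2 : {in A &, forall i j, i != j -> #|F i :&: F j| <= 2}.
Proof.
move=> i j; rewrite !inE => ir jr ij; rewrite /F setIACA setIid setIA.
by rewrite k33_free_rows // eq_sym.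
Qed.

Let edges_anchor : edges M setT setT =
  8 + \sum_(i in A) #|F i| + \sum_(c in ~: D) #|conbr M c|.
Proof.
rewrite edges_cols (big_setID D) /= setTI setTD; congr (_ + _); last first.
  by apply: eq_bigr => c _; rewrite setIT.
have := sum_conbr_nbr M [set: C] (in_setT r0); rewrite setIT -/D cD => ->.
congr (_ + _); rewrite setTD; apply: eq_bigr => i _; by rewrite setIT.
Qed.

(** A block with at least five points leaves at most three outside, so [blocks_big] has no exception
    and gives a total of at most 57. *)
Lemma anchor_le4 : {in A, forall i, #|F i| <= 4}.
Proof.
move=> i Ai; rewrite leqNgt; apply/negP => k5.
have := cardsID (F i) D; rewrite (setIidPr (sFD Ai)) cD => kO.
have A15 : #|A :\ i| = 15 by have := cardsD1 i A; rewrite Ai cA; lia.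
have := blocks_big sFD F2 Ai; rewrite A15 => H.
have {H} : 3 * (\sum_(j in A :\ i) #|F j|) <= 9 * 15 + 'C(#|D :\: F i|, 2) * (3 * #|F i|)./2.
  apply: H; first by lia.
  move=> j; rewrite in_setD1 => /andP [_ Aj]; left.
  apply: leq_trans (_ : #|D :\: F i| <= 3); last by lia.
  by rewrite subset_leq_card // setSD // sFD.
have := S60; rewrite (big_setD1 i Ai) /=.
have : #|F i| <= 8 by lia.
rewrite (_ : #|D :\: F i| = 8 - #|F i|) ?bin2; last by lia.
by move: k5; case: #|F i| => [|[|[|[|[|[|[|[|[|k]]]]]]]]] //= _ _; lia.
Qed.

Let n (k : nat) := #|[set i in A | #|F i| == k]|.

(** In 3 w <= C(w, 3) + 8 the slack is 2 for w = 2 and at least 5 for w < 2. The sum of the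
    right-hand sides is at most 56 + 128 = 184, which excludes blocks with fewer than two points. *)
Lemma anchor_counts : [/\ {in A, forall i, [|| #|F i| == 2, #|F i| == 3 | #|F i| == 4]},
   n 2 + n 3 + n 4 = 16, \sum_(i in A) #|F i| = 2 * n 2 + 3 * n 3 + 4 * n 4
   & 3 * (\sum_(i in A) #|F i|) + 2 * n 2 <= 184].
Proof.
pose n1 := \sum_(i in A) (#|F i| < 2).
have le : 3 * (\sum_(i in A) #|F i|) + 2 * n 2 + 5 * n1 <= 184.
  apply: leq_trans (_ : \sum_(i in A) ('C(#|F i|, 3) + 8) <= _); last first.
    rewrite big_split /= sum_nat_const cA.
    by have := blocks_triples sFD F2; rewrite cD (_ : 'C(8, 3) = 56) //; lia.
  rewrite /n /n1 card_sum_pred !big_distrr -!big_split /=; apply: leq_sum => i Ai.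
  by have := anchor_le4 Ai; case: #|F i| => [|[|[|[|[|k]]]]].
have n10 : n1 = 0 by lia.
have F24 : {in A, forall i, [|| #|F i| == 2, #|F i| == 3 | #|F i| == 4]}.
  move=> i Ai; have := anchor_le4 Ai.
  have /eqP : n1 == 0 by rewrite n10.
  rewrite /n1 (bigD1 i) //= => /eqP; rewrite addn_eq0 eqb0 -leqNgt => /andP [+ _].
  by case: #|F i| => [|[|[|[|[|k]]]]].
split=> //.
- rewrite /n !card_sum_pred -!big_split /= -cA -sum1_card; apply: eq_bigr => i Ai.
  by have := F24 i Ai; case: #|F i| => [|[|[|[|[|k]]]]].
- rewrite /n !card_sum_pred !big_distrr -!big_split /=; apply: eq_bigr => i Ai.
  by have := F24 i Ai; case: #|F i| => [|[|[|[|[|k]]]]].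
- lia.
Qed.

Let quad_set := [set i in A | #|F i| == 4].

Lemma anchor_trace_inj (es : seq C) : uniq es -> es =i D ->
  {in [set i in A | 2 < #|F i|] &, injective (fun i => trace es (nbr M i))}.
Proof.
move=> ues esD i j; rewrite in_set => /andP [Ai fi]; rewrite in_set => /andP [Aj fj] eqt.
apply/eqP; apply: contraT => ij.
have : #|F i| <= 2.
  have -> : #|F i| = count id (band (trace es (nbr M i)) (trace es (nbr M j))).
    by rewrite -eqt band_trace setIid (count_trace _ ues esD) setIC.
  rewrite band_trace (count_trace _ ues esD) setIC setIA.
  by move: Ai Aj; rewrite !inE => ir jr; rewrite k33_free_rows // eq_sym.
by rewrite leqNgt fi.
Qed.

(** Twelve quadruples have 48 incidences with eight points, more than 8 * 5. *)
Lemma anchor_point : 12 <= n 4 -> exists2 p, p \in D & 6 <= #|[set i in quad_set | M i p]|.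
Proof.
move=> n4; apply/exists_inP; apply: contraT; rewrite negb_exists_in => /forall_inP lt6.
have : \sum_(p in D) #|[set i in quad_set | M i p]| <= \sum_(p in D) 5.
  by apply: leq_sum => p Dp; have := lt6 p Dp; rewrite -leqNgt.
rewrite sum_nat_const cD; under eq_bigr do rewrite card_sum_pred.
rewrite exchange_big /=.
have -> : \sum_(i in quad_set) \sum_(p in D) M i p = n 4 * 4; last by lia.
rewrite -sum_nat_const; apply: eq_bigr => i; rewrite in_set => /andP [_ /eqP <-].
by rewrite -card_nbr setIC.
Qed.

Lemma anchor_planes : 12 <= n 4 -> exists es : seq C, [/\ uniq es, es =i D, size es = 8
  & {in quad_set, forall i, trace es (nbr M i) \in planes}].
Proof.
move=> n4; have [p Dp p6] := anchor_point n4.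
(* [sqs_labelling] considers the quadruples through the point labelled 0, so [p] comes first. *)
pose es0 := p :: enum (D :\ p).
have u0 : uniq es0 by rewrite /= enum_uniq mem_enum !inE eqxx.
have D0 : es0 =i D.
  by move=> c; rewrite inE mem_enum in_setD1; have [->|] := eqVneq c p.
have s0 : size es0 = 8.
  by rewrite /= -cardE; have := cardsD1 p D; rewrite Dp cD; lia.
pose Q := [seq trace es0 (nbr M i) | i <- enum quad_set].
have sub4 : {subset quad_set <= [set i in A | 2 < #|F i|]}.
  by move=> i; rewrite !in_set => /andP [-> /eqP ->].
have uQ : uniq Q.
  rewrite map_inj_in_uniq ?enum_uniq // => i j; rewrite !mem_enum => /sub4 qi /sub4 qj.
  exact: anchor_trace_inj.
have cnt i : count id (trace es0 (nbr M i)) = #|F i| by rewrite (count_trace _ u0 D0) setIC.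
have qQ : {subset Q <= quads}.
  move=> b /mapP [i]; rewrite mem_enum in_set => /andP [_ /eqP fi] ->.
  by rewrite mem_quads ?cnt // size_trace.
have szQ : 12 <= size Q by rewrite size_map -cardE.
have Q2 : {in Q &, forall b c, b != c -> count id (band b c) <= 2}.
  move=> _ _ /mapP [i qi ->] /mapP [j qj ->] neq; move: qi qj; rewrite !mem_enum.
  rewrite in_set => /andP [Ai _]; rewrite in_set => /andP [Aj _].
  rewrite band_trace (count_trace _ u0 D0) setIC setIA.
  have ij : i != j by apply: contraNneq neq => ->.
  by move: Ai Aj; rewrite !inE => ir jr; rewrite k33_free_rows // eq_sym.
have six : 6 <= count (fun b => nth false b 0) Q.
  apply: leq_trans p6 _; rewrite count_map -size_filter -(card_uniqP _); last first.
    by rewrite filter_uniq // enum_uniq.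
  apply/subset_leq_card/subsetP => i; rewrite in_set => /andP [qi Mi].
  by rewrite mem_filter mem_enum qi /= !inE Mi.
have [s sf sp] := sqs_labelling uQ qQ szQ Q2 six.
have [ss sub] := complete_orderP (allP fano_orders_complete s sf).
have [||u1 e1 s1 lt1] := @relabel C es0 p s u0; rewrite ?s0 //.
exists [seq nth p es0 i | i <- s]; split=> //.
- by move=> c; rewrite e1 D0.
- by rewrite s1 s0.
move=> i qi; rewrite -permute_trace //; apply: sp; apply/mapP.
by exists i; rewrite ?mem_enum.
Qed.

(** An affine relabelling brings the missing planes and the two-point blocks to a normal form, for
    which the search result feeds [outer_bound]. *)
Lemma anchor_normal (es : seq C) : uniq es -> es =i D -> size es = 8 ->
  {in quad_set, forall i, trace es (nbr M i) \in planes} ->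
  (14 - n 4, n 2) \in [:: (1, 0); (2, 0); (1, 1); (0, 2)] -> n 4 <= 14 ->
  \sum_(c in ~: D) #|conbr M c| <= 63 + (8 + (1 < 14 - n 4 + n 2)).
Proof.
move=> ues esD sz8 planar types n14.
have [F24 n16 _ _] := anchor_counts.
have n3 : n 3 = 2 + (14 - n 4) - n 2 by lia.
pose Q := [seq trace es (nbr M i) | i <- enum quad_set].
pose miss := [seq m <- planes | m \notin Q].
pose ws := [seq trace es (nbr M i) | i <- enum [set i in A | #|F i| == 2]].
have cnt i : count id (trace es (nbr M i)) = #|F i| by rewrite (count_trace _ ues esD) setIC.
have sub4 : {subset quad_set <= [set i in A | 2 < #|F i|]}.
  by move=> i; rewrite !in_set => /andP [-> /eqP ->].
have uQ : uniq Q.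
  rewrite map_inj_in_uniq ?enum_uniq // => i j; rewrite !mem_enum => /sub4 qi /sub4 qj.
  exact: anchor_trace_inj.
have Qp : {subset Q <= planes} by move=> b /mapP [i]; rewrite mem_enum => /planar ? ->.
have szw : size ws = n 2 by rewrite size_map -cardE.
have up : uniq planes by vm_compute.
have szm : size miss = 14 - n 4.
  have : size [seq m <- planes | m \in Q] = n 4.
    rewrite (_ : n 4 = size Q); last by rewrite size_map -cardE.
    apply/perm_size/uniq_perm; rewrite ?filter_uniq // => m.
    by rewrite mem_filter andb_idr // => /Qp.
  rewrite /miss !size_filter => eq4.
  have E : count (mem Q) planes + count (fun m => m \notin Q) planes = 14 := count_predC _ _.
  by rewrite -E (_ : count (mem Q) planes = n 4) ?addKn.
have : normalizable affines miss ws.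
  apply: normalizable_all; rewrite ?szm ?szw // ?filter_uniq //.
  - by move=> m; rewrite mem_filter => /andP [].
  - move=> w /mapP [i]; rewrite mem_enum in_set => /andP [_ /eqP fi] ->.
    by rewrite mem_pairs ?cnt // size_trace.
case/normalizableP=> s sa [sp].
set f := (_, _) => ff.
have cs := allP affines_complete s sa.
have [ss sub] := complete_orderP cs.
have c0 : C by case: (es) sz8.
have [||u2 e2 s2 lt2] := @relabel C es c0 s ues; rewrite ?sz8 //.
set es2 := [seq nth c0 es i | i <- s] in u2 e2 s2.
have e2D : es2 =i D by move=> c; rewrite e2 esD.
have sz2 : size es2 = 8 by rewrite s2.
have tr i : trace es2 (nbr M i) = permute s (trace es (nbr M i)) by rewrite (permute_trace c0).
have cnt2 i : count id (trace es2 (nbr M i)) = #|F i| by rewrite (count_trace _ u2 e2D) setIC.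
have [_ eqpl] := uniq_min_size up sp (eq_leq (size_map _ _)).
have planes8 : all (fun m => size m == 8) planes by vm_compute.
have pl8 m : m \in planes -> size m = 8 by move=> /(allP planes8) /eqP.
have smf : {subset f.1 <= planes}.
  move=> m /mapP [m' mm ->]; rewrite eqpl map_f //.
  by move: mm; rewrite mem_filter => /andP [].
have n3E : n 3 = 2 + size f.1 - size f.2 by rewrite /f /= !(size_map (permute s)) szm szw.
have planar2 i : i \in quad_set -> trace es2 (nbr M i) \in planes.
  by move=> qi; rewrite tr eqpl map_f ?planar.
have missE m : m \in planes -> m \notin f.1 -> exists2 i, i \in quad_set & m = trace es2 (nbr M i).
  rewrite eqpl => /mapP [m' pm ->] /= nm.
  have : m' \in Q by apply: contraR nm => nm; rewrite map_f // mem_filter nm.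
  by case/mapP => i; rewrite mem_enum => qi ->; exists i; rewrite ?tr.
apply: (outer_bound fr u2 e2D sz2 (miss := f.1) (ws := f.2) (t := n 3)) => //.
- move=> i Ai fi; have qi : i \in quad_set by rewrite inE Ai fi.
  rewrite planar2 //=; apply/negP => /mapP [m]; rewrite mem_filter => /andP [/negP nm pm].
  rewrite tr => /(permute_inj cs) E; apply: nm; rewrite -E ?size_trace ?pl8 //.
  by apply/mapP; exists i; rewrite ?mem_enum.
(* A triple lies in some plane; if that plane were a block, the two blocks would share three
   points. *)
- move=> i Ai fi.
  have [||m pm /andP [sm /eqP cm]] := @triple_in_plane (trace es2 (nbr M i)).
  + by rewrite size_trace.
  + by rewrite cnt2.
  have [mf|] := boolP (m \in f.1).
    by apply/flattenP; exists (subtriples m); rewrite ?map_f.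
  case/(missE _ pm) => j; rewrite inE => /andP [Aj /eqP fj] E.
  have ij : i != j by apply/eqP => eqij; move: fi; rewrite eqij fj.
  have := F2 Ai Aj ij; rewrite /F setIACA setIid.
  move: cm; rewrite E band_trace (count_trace _ u2 e2D) setIC => -> //.
- by rewrite /= -map_comp; apply: eq_map => i /=; rewrite tr.
- by have := normal_form_check ff; rewrite n3E /f /= !(size_map (permute s)) szm szw.
Qed.

Theorem anchor_bound : edges M setT setT <= 140.
Proof.
have [_ n16 S le] := anchor_counts.
rewrite edges_anchor.
have n4 : 12 <= n 4 by have := S60; lia.
have [es [ues esD sz8 pl]] := anchor_planes n4.
have := anchor_normal ues esD sz8 pl.
rewrite !inE !xpair_eqE => H.
(* The total 48 + n 4 - n 2 is at least 60, and the weighted bound becomes 3 n 4 - n 2 <= 40. *)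
have : (n 4 = 13 /\ n 2 = 0) \/ (n 4 = 12 /\ n 2 = 0) \/ (n 4 = 13 /\ n 2 = 1)
  \/ (n 4 = 14 /\ n 2 = 2) by have := S60; lia.
case=> [|[|[]]] [E4 E2]; move: H; rewrite E4 E2 => /(_ isT isT) /=; lia.
Qed.

End Anchor.

(** * K33-free matrices *)

(* The rows with d = 8 and S >= 60 in the notation of the header. *)
Definition anchor (R C : finType) (M : R -> C -> bool) (r : R) :=
  (#|nbr M r| == 8) && (60 <= \sum_(i in [set~ r]) #|nbr M r :&: nbr M i|).

Lemma edges_tr (R C : finType) (M : R -> C -> bool) :
  edges (fun c r => M r c) setT setT = edges M setT setT.
Proof. by rewrite [RHS]edges_cols. Qed.

(** Sum [blocks_bound] over the rows. The sum of S + d over the rows is the sum of the squared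
    column degrees and absorbs one of the twelve d, which leaves the factor 11. *)
Lemma degree_squares_le (R C : finType) (M : R -> C -> bool) :
  biclique_free 3 3 M -> #|[set: R]| = 17 -> #|[set: C]| = 17 ->
  (forall r, ~~ anchor M r) ->
  \sum_c #|conbr M c| * #|conbr M c| + 11 * edges M setT setT <=
  \sum_r #|nbr M r| * #|nbr M r| + 17 * 91.
Proof.
move=> fr cR cC noanchor.
pose S r := \sum_(i in [set~ r]) #|nbr M r :&: nbr M i|.
have local r : S r + 12 * #|nbr M r| <= #|nbr M r| * #|nbr M r| + 91.
  have c16 : #|[set~ r]| = 16 by have := cardsC [set r]; rewrite cards1 -cardsT cR; lia.
  apply: (blocks_bound c16) (noanchor r) => [i _|i j|].
  - exact: subsetIl.
  - rewrite !inE => ir jr ij; rewrite setIACA setIid setIA.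
    by rewrite k33_free_rows // eq_sym.
  - by rewrite -cC subset_leq_card.
have squares : \sum_c #|conbr M c| * #|conbr M c| = \sum_r S r + \sum_r #|nbr M r|.
  have row r : \sum_(c in nbr M r) #|conbr M c| = S r + #|nbr M r|.
    have := sum_conbr_nbr M [set: C] (in_setT r); rewrite setIT setTD addnC.
    under eq_bigr do rewrite setIT.
    by under [X in _ = X + _]eq_bigr do rewrite setIT.
  rewrite -big_split /=; under [RHS]eq_bigr do rewrite -row.
  under [LHS]eq_bigr do rewrite -sum_nat_const.
  rewrite (exchange_big_dep predT) //=; apply: eq_bigr => r _.
  rewrite big_mkcond [RHS]big_mkcond; apply: eq_bigr => c _.
  by rewrite !inE.
have E : edges M setT setT = \sum_r #|nbr M r|.
  rewrite /edges big_mkcond; apply: eq_bigr => r _; by rewrite inE setIT.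
have : \sum_r (S r + 12 * #|nbr M r|) <= \sum_r (#|nbr M r| * #|nbr M r| + 91).
  by apply: leq_sum => r _; exact: local.
rewrite big_split /= [leqRHS]big_split /=.
rewrite -[\sum_r 12 * _]big_distrr /= sum_nat_const -cardsT cR -E squares; lia.
Qed.

Theorem k33_bound (R C : finType) (M : R -> C -> bool) :
  biclique_free 3 3 M -> #|[set: R]| = 17 -> #|[set: C]| = 17 ->
  edges M setT setT <= 140.
Proof.
move=> fr cR cC; pose M' c r := M r c; have fr' : biclique_free 3 3 M' := biclique_free_tr fr.
have [/existsP [r /andP [/eqP d8 S60]]|] := boolP [exists r, anchor M r].
  exact: anchor_bound fr cR cC d8 S60.
rewrite negb_exists => /forallP noR.
have [/existsP [c /andP [/eqP d8 S60]]|] := boolP [exists c, anchor M' c].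
  rewrite -edges_tr; exact: anchor_bound fr' cC cR d8 S60.
rewrite negb_exists => /forallP noC.
have := degree_squares_le fr cR cC noR; have := degree_squares_le fr' cC cR noC.
rewrite edges_tr /conbr /nbr /M' /=; lia.
Qed.

(** * Colourings *)

Definition color_class (t b : nat) (c : edge_coloring t ('I_b + 'I_b)%type) (k : 'I_t)
    (i j : 'I_b) := c [set inl i; inr j] == k.

Lemma biclique_copy (t b n : nat) (c : edge_coloring t ('I_b + 'I_b)%type) (k : 'I_t) :
  ~~ biclique_free n n (color_class c k) ->
  monochromatic_copy (@complete_bipartite n n) (@complete_bipartite b b) c k.
Proof.
case/forallPn => A /forallPn [B]; rewrite negb_imply => /andP [/andP [/eqP cA /eqP cB]].
move=> /exists_inPn noex.
have mono a d : a \in A -> d \in B -> c [set inl a; inr d] = k.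
  by move=> Aa Bd; have /exists_inPn/(_ d Bd) := noex a Aa; rewrite negbK => /eqP.
pose fA (i : 'I_n) := enum_val (cast_ord (esym cA) i).
pose fB (i : 'I_n) := enum_val (cast_ord (esym cB) i).
have injA : injective fA by move=> i j /enum_val_inj /cast_ord_inj.
have injB : injective fB by move=> i j /enum_val_inj /cast_ord_inj.
exists (fun u => match u with inl i => inl (fA i) | inr j => inr (fB j) end).
split; first by move=> [i|i] [j|j] // [] => [/injA|/injB] ->.
move=> [i|i] [j|j] // _; split=> //; last rewrite setUC; apply: mono; exact: enum_valP.
Qed.

Lemma sum_color_classes (t b : nat) (c : edge_coloring t ('I_b + 'I_b)%type) :
  \sum_k edges (color_class c k) setT setT = b * b.
Proof.
rewrite /edges exchange_big /= -[X in X * _]card_ord -cardsT -sum_nat_const.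
apply: eq_bigr => i _; under eq_bigr do rewrite card_nbr.
rewrite exchange_big /= -[RHS]card_ord -sum1_card big_mkcond [RHS]big_mkcond.
apply: eq_bigr => j _; rewrite inE (bigD1 (c [set inl i; inr j])) //= /color_class eqxx.
by rewrite big1 // => k; rewrite eq_sym => /negbTE ->.
Qed.

Lemma ramsey_upper : bipartite_ramsey_property [tuple 2; 2; 3] 17.
Proof.
move=> c; have [/existsP [k nf]|] := boolP [exists k,
    ~~ biclique_free (tnth [tuple 2; 2; 3] k) (tnth [tuple 2; 2; 3] k) (color_class c k)].
  by exists k; exact: biclique_copy.
rewrite negb_exists => /forallP fr; have {}fr k := negbNE (fr k).
have c17 : #|[set: 'I_17]| = 17 by rewrite cardsT card_ord.
have := sum_color_classes c; rewrite !big_ord_recl big_ord0.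
pose E k := edges (color_class c k) setT setT; rewrite -!/(E _).
have : E ord0 <= 74 := c4_bound_17_17 (fr ord0) c17 c17.
have : E (lift ord0 ord0) <= 74 := c4_bound_17_17 (fr (lift ord0 ord0)) c17 c17.
have : E (lift ord0 (lift ord0 ord0)) <= 140 :=
  k33_bound (fr (lift ord0 (lift ord0 ord0))) c17 c17.
lia.
Qed.

(** * The colouring for the lower bound *)

Definition diff4 (x y : nat) : nat := (y + 4 - x) %% 4.

(* Vertices are elements (x %% 4, x %/ 4) of Z4 x Z4, and the colour of xy
   depends on y - x only. *)
Definition cayley_color (x y : nat) : nat :=
  let d := diff4 (x %% 4) (y %% 4) + 4 * diff4 (x %/ 4) (y %/ 4) in
  if d \in [:: 0; 5; 6; 9] then 0 else if d \in [:: 7; 10; 11; 12] then 1 else 2.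

Definition cayley_rows (k : nat) : seq bitseq :=
  [seq [seq cayley_color x y == k | y <- iota 0 16] | x <- iota 0 16].

Definition common2 (T : seq bitseq) : bool :=
  every (fun i => every (fun j =>
    (i == j) || (count id (band (nth [::] T i) (nth [::] T j)) <= 1)) (iota 0 16)) (iota 0 16).

Definition common3 (T : seq bitseq) : bool :=
  every (fun i => every (fun j => every (fun k => [|| i == j, i == k, j == k |
    count id (band (band (nth [::] T i) (nth [::] T j)) (nth [::] T k)) <= 2])
    (iota 0 16)) (iota 0 16)) (iota 0 16).

Lemma cayley_check :
  [&& common2 (cayley_rows 0), common2 (cayley_rows 1) & common3 (cayley_rows 2)].
Proof. by vm_compute. Qed.

(** An edge determines its left and right ends, so [pick] recovers the ordered pair; other sets get
    a default colour. *)
Definition cayley_coloring (b : nat) : edge_coloring 3 ('I_b + 'I_b)%type :=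
  fun S => if [pick p : 'I_b * 'I_b | S == [set inl p.1; inr p.2]] is Some p
    then inord (cayley_color p.1 p.2) else ord0.
Arguments cayley_coloring : clear implicits.

Lemma cayley_coloringE (b : nat) (i j : 'I_b) :
  cayley_coloring b [set inl i; inr j] = cayley_color i j :> nat.
Proof.
rewrite /cayley_coloring; case: pickP => [[i' j'] /= /eqP /setP E|/(_ (i, j))]; last first.
  by rewrite eqxx.
have := E (inl i); have := E (inr j); rewrite !inE !eqxx /= => /esym/eqP [<-] /esym.
rewrite orbF => /eqP [<-]; rewrite inordK //.
by rewrite /cayley_color; case: ifP => // _; case: ifP.
Qed.

(** A copy is connected, so it respects the two sides or exchanges them; in the second case the
    roles of the parts are swapped. *)
Lemma monochromatic_copy_rect (t b n : nat) (c : edge_coloring t ('I_b + 'I_b)%type) (k : 'I_t) :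
  monochromatic_copy (@complete_bipartite n.+1 n.+1) (@complete_bipartite b b) c k ->
  exists g h : 'I_n.+1 -> 'I_b,
    [/\ injective g, injective h & forall i j, c [set inl (g i); inr (h j)] = k].
Proof.
case=> f [injf mono].
have adj i j := mono (inl i) (inr j) isT.
case E0 : (f (inl ord0)) => [a|a].
  have [h hE] : exists h : 'I_n.+1 -> 'I_b, forall j, f (inr j) = inr (h j).
    (* The default [a] is never taken: [f (inr j)] is adjacent to a left vertex. *)
    exists (fun j => if f (inr j) is inr d then d else a) => j.
    by have [] := adj ord0 j; rewrite E0; case: (f (inr j)).
  have [g gE] : exists g : 'I_n.+1 -> 'I_b, forall j, f (inl j) = inl (g j).
    exists (fun j => if f (inl j) is inl d then d else a) => j.
    by have [] := adj j ord0; rewrite hE; case: (f (inl j)).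
  exists g, h; split=> [i j E|i j E|i j].
  - by have := injf (inl i) (inl j); rewrite !gE E => /(_ erefl) [].
  - by have := injf (inr i) (inr j); rewrite !hE E => /(_ erefl) [].
  - by have [_] := adj i j; rewrite gE hE.
have [h hE] : exists h : 'I_n.+1 -> 'I_b, forall j, f (inr j) = inl (h j).
  exists (fun j => if f (inr j) is inl d then d else a) => j.
  by have [] := adj ord0 j; rewrite E0; case: (f (inr j)).
have [g gE] : exists g : 'I_n.+1 -> 'I_b, forall j, f (inl j) = inr (g j).
  exists (fun j => if f (inl j) is inr d then d else a) => j.
  by have [] := adj j ord0; rewrite hE; case: (f (inl j)).
exists h, g; split=> [i j E|i j E|i j].
- by have := injf (inr i) (inr j); rewrite !hE E => /(_ erefl) [].
- by have := injf (inl i) (inl j); rewrite !gE E => /(_ erefl) [].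
- by have [_] := adj j i; rewrite gE hE setUC.
Qed.

Lemma leq_count_common (n : nat) (P : pred nat) (h : 'I_n -> 'I_16) :
  injective h -> (forall j, P (h j)) -> n <= count P (iota 0 16).
Proof.
move=> injh Ph; rewrite -[n in n <= _]card_ord -size_filter.
have <- : size (codom (fun j => val (h j))) = #|'I_n| by rewrite size_codom.
apply: uniq_leq_size; first by apply/injectiveP => i j /val_inj /injh.
by move=> _ /codomP [j ->]; rewrite mem_filter Ph mem_iota ltn_ord.
Qed.

Lemma nth_cayley_rows (k : nat) (x : 'I_16) :
  nth [::] (cayley_rows k) x = [seq cayley_color x y == k | y <- iota 0 16].
Proof. by rewrite (nth_map 0) ?size_iota // nth_iota. Qed.

Lemma band_map (p q : pred nat) (l : seq nat) : band (map p l) (map q l) = map (predI p q) l.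
Proof. by elim: l => [|x l IH] //=; rewrite IH. Qed.

Lemma common2_free (k : nat) (g h : 'I_2 -> 'I_16) : common2 (cayley_rows k) ->
  injective g -> injective h -> ~ forall i j, cayley_color (g i) (h j) = k.
Proof.
rewrite /common2 everyE => free injg injh mono.
have in16 (x : 'I_16) : val x \in iota 0 16 by rewrite mem_iota ltn_ord.
have := allP free _ (in16 (g ord0)); rewrite everyE => /allP/(_ _ (in16 (g ord_max))).
rewrite !nth_cayley_rows band_map count_map; case/orP => [/eqP/val_inj/injg //|].
by rewrite leqNgt (leq_count_common injh) // => j /=; rewrite !mono eqxx.
Qed.

Lemma common3_free (k : nat) (g h : 'I_3 -> 'I_16) : common3 (cayley_rows k) ->
  injective g -> injective h -> ~ forall i j, cayley_color (g i) (h j) = k.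
Proof.
rewrite /common3 everyE => free injg injh mono.
have in16 (x : 'I_16) : val x \in iota 0 16 by rewrite mem_iota ltn_ord.
have := allP free _ (in16 (g ord0)).
rewrite everyE => /allP/(_ _ (in16 (g (lift ord0 ord0)))).
rewrite everyE => /allP/(_ _ (in16 (g ord_max))).
rewrite !nth_cayley_rows !band_map count_map.
case/or4P => [/eqP/val_inj/injg //|/eqP/val_inj/injg //|/eqP/val_inj/injg //|].
by rewrite leqNgt (leq_count_common injh) // => j /=; rewrite !mono eqxx.
Qed.

(** The colouring for [b] is a restriction of the one for 16, so a copy widens to one that
    [cayley_check] excludes. *)
Lemma cayley_lower (b : nat) : b <= 16 -> ~ bipartite_ramsey_property [tuple 2; 2; 3] b.
Proof.
move=> b16 /(_ (cayley_coloring b)) [k copy].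
have injw : injective (widen_ord b16) by move=> i j /(congr1 val) /= /val_inj.
have rect n : monochromatic_copy (@complete_bipartite n.+1 n.+1) (@complete_bipartite b b)
    (cayley_coloring b) k -> exists g h : 'I_n.+1 -> 'I_16,
    [/\ injective g, injective h & forall i j, cayley_color (g i) (h j) = k].
  case/monochromatic_copy_rect => g [h [injg injh mono]].
  exists (widen_ord b16 \o g), (widen_ord b16 \o h).
  by split=> [||i j]; [exact: inj_comp.. | rewrite -(mono i j) cayley_coloringE].
have [c0 c1 c2] := and3P cayley_check.
case: k copy rect => [[|[|[|k]]] lt] copy rect; last by exfalso; clear -lt.
- by have [g [h [ig ih]]] := rect 1 copy; exact: common2_free c0 ig ih.
- by have [g [h [ig ih]]] := rect 1 copy; exact: common2_free c1 ig ih.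
- by have [g [h [ig ih]]] := rect 2 copy; exact: common3_free c2 ig ih.
Qed.

Theorem theorem1p1 : is_bipartite_ramsey_number [tuple 2; 2; 3] 17.
Proof.
split=> // [|b _ prop]; first exact: ramsey_upper.
by rewrite leqNgt; apply/negP => /cayley_lower.
Qed.
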